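(* Let $X$ be a Banach space, $U$ a normed linear space, $A$ the generator of a strongly continuous semigroup $T$ of bounded linear operators on $X$, and let $f:X\times U\to X$ satisfy: (1) for all $C>0$ there is $L_f(C)>0$ such that $\|f(x,v)-f(y,v)\|_X\le L_f(C)\|x-y\|_X$ for all $x,y\in B_C$ and all $v\in U$; (2) $f(x,\cdot)$ is continuous for all $x\in X$, and $f(0,0)=0$; (3) there exist $\sigma\in\mathcal{K}$ and $r>0$ such that $\|f(x,v)-f(x,0)\|_X\le\sigma(\|v\|_U)$ for all $v\in U$ with $\|v\|_U<r$ and all $x\in\overline{B_r}$. Assume that the system $\dot x(t)=Ax(t)+f(x(t),u(t))$ (mild solutions, inputs in $PC(\mathbb{R}_+,U)$) is forward complete. Then the following statements about this system are equivalent: (i) it is ISS; (ii) it is UAG and BRS; (iii) it is ULIM, ULS and BRS; (iv) it is ULIM and UGS; (v) it is ULIM, 0-ULS, and BRS.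
   Context: $\mathcal{U}=PC(\mathbb{R}_+,U)$ is the space of globally bounded, piecewise continuous, right-continuous functions $u:\mathbb{R}_+\to U$ with $\|u\|_{\mathcal{U}}=\sup_{t\ge0}\|u(t)\|_U$. For $x\in X$, $u\in\mathcal{U}$, $\phi(\cdot,x,u)$ denotes the mild solution with $x(0)=x$, i.e. the continuous solution of $x(t)=T(t)x(0)+\int_0^tT(t-s)f(x(s),u(s))\,ds$ (under (1), (2) it exists locally and is unique). Forward completeness: $\phi(t,x,u)$ is defined for all $t\ge0$, $x\in X$, $u\in\mathcal{U}$. $\mathcal{K}$: continuous strictly increasing $\gamma:\mathbb{R}_+\to\mathbb{R}_+$ with $\gamma(0)=0$; $\mathcal{K}_\infty$: unbounded elements of $\mathcal{K}$; $\mathcal{L}$: continuous strictly decreasing $\gamma:\mathbb{R}_+\to\mathbb{R}_+$ with limit $0$ at $\infty$; $\mathcal{KL}$: continuous $\beta:\mathbb{R}_+^2\to\mathbb{R}_+$ with $\beta(\cdot,t)\in\mathcal{K}$ for all $t\ge0$ and $\beta(r,\cdot)\in\mathcal{L}$ for all $r>0$. $B_r$, $B_{r,\mathcal{U}}$ are the open balls of radius $r$ around $0$ in $X$, $\mathcal{U}$; bars denote closure. - ISS: there are $\beta\in\mathcal{KL}$, $\gamma\in\mathcal{K}$ with $\|\phi(t,x,u)\|_X\le\beta(\|x\|_X,t)+\gamma(\|u\|_{\mathcal{U}})$ for all $x\in X$, $u\in\mathcal{U}$, $t\ge0$. - UAG: there is $\gamma\in\mathcal{K}_\infty\cup\{0\}$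 such that for all $\varepsilon,r>0$ there is $\tau=\tau(\varepsilon,r)<\infty$ such that $\|\phi(t,x,u)\|_X\le\varepsilon+\gamma(\|u\|_{\mathcal{U}})$ for all $u\in\mathcal{U}$, $x\in B_r$, $t\ge\tau$. - BRS: for all $C,\tau>0$, $\sup\{\|\phi(t,x,u)\|_X:\|x\|_X\le C,\|u\|_{\mathcal{U}}\le C,t\in[0,\tau]\}<\infty$. - ULIM: there is $\gamma\in\mathcal{K}\cup\{0\}$ such that for all $\varepsilon>0$, $r>0$ there is $\tau=\tau(\varepsilon,r)$ such that for all $x$ with $\|x\|_X\le r$ and all $u\in\mathcal{U}$ there is $t\le\tau$ with $\|\phi(t,x,u)\|_X\le\varepsilon+\gamma(\|u\|_{\mathcal{U}})$. - ULS: there are $\sigma\in\mathcal{K}_\infty$, $\gamma\in\mathcal{K}_\infty\cup\{0\}$, $r>0$ with $\|\phi(t,x,u)\|_X\le\sigma(\|x\|_X)+\gamma(\|u\|_{\mathcal{U}})$ for all $x\in\overline{B_r}$, $u\in\overline{B_{r,\mathcal{U}}}$, $t\ge0$. - UGS: there are $\sigma\in\mathcal{K}_\infty$, $\gamma\in\mathcal{K}_\infty\cup\{0\}$ such that the last estimate holds for all $x\in X$, $u\in\mathcal{U}$, $t\ge0$. - 0-ULS: there are $\sigma\in\mathcal{K}_\infty$, $r>0$ with $\|\phi(t,x,0)\|_X\le\sigma(\|x\|_X)$ for all $x\in\overline{B_r}$, $t\ge0$. *)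

(* Defs.v *)
From Stdlib Require Import Reals List ClassicalEpsilon.
From Coquelicot Require Import Coquelicot.

Set Implicit Arguments.
Unset Strict Implicit.
Unset Printing Implicit Defensive.

Open Scope R_scope.

(* Functions on R_+ (comparison functions, inputs, trajectories, semigroups) are
   encoded as functions on R of which only the values at nonnegative arguments
   matter. *)

Definition Rplus_set (t : R) : Prop := 0 <= t.

(* Nonnegativity on R_+ follows from g 0 = 0 and strict monotonicity. *)
Definition class_K (g : R -> R) : Prop :=
  continuous_on Rplus_set g /\
  (forall r s, 0 <= r -> r < s -> g r < g s) /\
  g 0 = 0.

Definition class_Kinf (g : R -> R) : Prop :=
  class_K g /\ forall M, exists r, 0 <= r /\ M < g r.

(* Nonnegativity on R_+ follows from monotonicity and the limit. *)
Definition class_L (g : R -> R) : Prop :=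
  continuous_on Rplus_set g /\
  (forall s t, 0 <= s -> s < t -> g t < g s) /\
  is_lim g p_infty 0.

Definition class_KL (b : R -> R -> R) : Prop :=
  continuous_on (fun p : R * R => 0 <= fst p /\ 0 <= snd p)
                (fun p : R * R => b (fst p) (snd p)) /\
  (forall t, 0 <= t -> class_K (fun r => b r t)) /\
  (forall r, 0 < r -> class_L (b r)).

Definition zero_fun (g : R -> R) : Prop := forall r, 0 <= r -> g r = 0.

Definition class_K0 (g : R -> R) : Prop := class_K g \/ zero_fun g.

Definition class_Kinf0 (g : R -> R) : Prop := class_Kinf g \/ zero_fun g.

(* As usual, piecewise continuity means: finitely many discontinuities on every
   bounded interval, and one-sided limits at each of them. *)
Definition PC (U : NormedModule R_AbsRing) (u : R -> U) : Prop :=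
  (forall t, 0 <= t -> filterlim u (at_right t) (locally (u t))) /\
  (forall t, 0 < t -> exists l : U, filterlim u (at_left t) (locally l)) /\
  (forall b, exists D : list R,
     forall t, 0 < t -> t <= b -> ~ In t D -> continuous u t) /\
  (exists M, forall t, 0 <= t -> norm (u t) <= M).

Definition norm_PC (U : NormedModule R_AbsRing) (u : R -> U) : R :=
  real (Lub_Rbar (fun r => exists t, 0 <= t /\ r = norm (u t))).

Definition C0_semigroup (X : NormedModule R_AbsRing) (T : R -> X -> X) : Prop :=
  (forall t, 0 <= t -> is_linear (T t)) /\
  (forall x, T 0 x = x) /\
  (forall s t x, 0 <= s -> 0 <= t -> T (s + t) x = T s (T t x)) /\
  (forall x, filterlim (fun h => T h x) (at_right 0) (locally x)).

(* [A], defined on the domain [D] (its values outside [D] are irrelevant), is the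
   generator of [T]. *)
Definition is_generator (X : NormedModule R_AbsRing) (T : R -> X -> X)
    (D : X -> Prop) (A : X -> X) : Prop :=
  let limit x y :=
    filterlim (fun h => scal (/ h) (minus (T h x) x)) (at_right 0) (locally y) in
  (forall x, D x <-> exists y, limit x y) /\
  (forall x, D x -> limit x (A x)).

(* For continuous [x], piecewise continuous [u] and nonlinearities as considered
   here the integrand is piecewise continuous, so the Riemann integral suffices. *)
Definition is_mild_solution (X : CompleteNormedModule R_AbsRing)
    (U : NormedModule R_AbsRing) (T : R -> X -> X) (f : X -> U -> X)
    (x0 : X) (u : R -> U) (x : R -> X) : Prop :=
  continuous_on Rplus_set x /\
  x 0 = x0 /\
  forall t, 0 <= t ->
    ex_RInt (fun s => T (t - s) (f (x s) (u s))) 0 t /\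
    x t = plus (T t (x 0)) (RInt (fun s => T (t - s) (f (x s) (u s))) 0 t).

Definition forward_complete (X : CompleteNormedModule R_AbsRing)
    (U : NormedModule R_AbsRing) (T : R -> X -> X) (f : X -> U -> X) : Prop :=
  forall (x : X) (u : R -> U), PC u -> exists y, is_mild_solution T f x u y.

(* The flow map, [flow T f t x u] being the value at time t of the mild solution
   with initial state x and input u. Such a solution exists by forward
   completeness, and its restriction to R_+ is unique when f is Lipschitz on
   bounded sets, so the choice made by [epsilon] is immaterial. *)
Definition flow (X : CompleteNormedModule R_AbsRing)
    (U : NormedModule R_AbsRing) (T : R -> X -> X) (f : X -> U -> X)
    (t : R) (x : X) (u : R -> U) : X :=
  epsilon (inhabits (fun _ : R => zero : X)) (is_mild_solution T f x u) t.

Definition lipschitz_on_balls (X U : NormedModule R_AbsRing)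
    (f : X -> U -> X) : Prop :=
  forall C, 0 < C -> exists L, 0 < L /\
    forall (x y : X) (v : U), norm x < C -> norm y < C ->
      norm (minus (f x v) (f y v)) <= L * norm (minus x y).

Definition continuous_in_input (X U : NormedModule R_AbsRing)
    (f : X -> U -> X) : Prop :=
  forall (x : X) (v : U), continuous (f x) v.

Definition input_K_bound (X U : NormedModule R_AbsRing)
    (f : X -> U -> X) : Prop :=
  exists (sigma : R -> R) (r : R), class_K sigma /\ 0 < r /\
    forall (x : X) (v : U), norm v < r -> norm x <= r ->
      norm (minus (f x v) (f x zero)) <= sigma (norm v).

Definition ISS (X U : NormedModule R_AbsRing)
    (phi : R -> X -> (R -> U) -> X) : Prop :=
  exists (beta : R -> R -> R) (gamma : R -> R),
    class_KL beta /\ class_K gamma /\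
    forall x u t, PC u -> 0 <= t ->
      norm (phi t x u) <= beta (norm x) t + gamma (norm_PC u).

Definition UAG (X U : NormedModule R_AbsRing)
    (phi : R -> X -> (R -> U) -> X) : Prop :=
  exists gamma : R -> R, class_Kinf0 gamma /\
    forall eps r, 0 < eps -> 0 < r -> exists tau, 0 <= tau /\
      forall u x t, PC u -> norm x < r -> tau <= t ->
        norm (phi t x u) <= eps + gamma (norm_PC u).

Definition BRS (X U : NormedModule R_AbsRing)
    (phi : R -> X -> (R -> U) -> X) : Prop :=
  forall C tau, 0 < C -> 0 < tau -> exists M,
    forall x u t, PC u -> norm x <= C -> norm_PC u <= C -> 0 <= t <= tau ->
      norm (phi t x u) <= M.

Definition ULIM (X U : NormedModule R_AbsRing)
    (phi : R -> X -> (R -> U) -> X) : Prop :=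
  exists gamma : R -> R, class_K0 gamma /\
    forall eps r, 0 < eps -> 0 < r -> exists tau,
      forall x u, PC u -> norm x <= r -> exists t, 0 <= t <= tau /\
        norm (phi t x u) <= eps + gamma (norm_PC u).

Definition ULS (X U : NormedModule R_AbsRing)
    (phi : R -> X -> (R -> U) -> X) : Prop :=
  exists (sigma gamma : R -> R) (r : R),
    class_Kinf sigma /\ class_Kinf0 gamma /\ 0 < r /\
    forall x u t, PC u -> norm x <= r -> norm_PC u <= r -> 0 <= t ->
      norm (phi t x u) <= sigma (norm x) + gamma (norm_PC u).

Definition UGS (X U : NormedModule R_AbsRing)
    (phi : R -> X -> (R -> U) -> X) : Prop :=
  exists sigma gamma : R -> R,
    class_Kinf sigma /\ class_Kinf0 gamma /\
    forall x u t, PC u -> 0 <= t ->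
      norm (phi t x u) <= sigma (norm x) + gamma (norm_PC u).

Definition zero_ULS (X U : NormedModule R_AbsRing)
    (phi : R -> X -> (R -> U) -> X) : Prop :=
  exists (sigma : R -> R) (r : R), class_Kinf sigma /\ 0 < r /\
    forall x t, norm x <= r -> 0 <= t ->
      norm (phi t x (fun _ => zero)) <= sigma (norm x).

(* Main.v *)
Require Import Defs.
From Stdlib Require Import Reals Lra List ClassicalEpsilon Classical.
From Coquelicot Require Import Coquelicot.

(** All four characterizations reduce to one implication: a system that is ULIM,
    has a stable origin for the zero input, and is BRS, is ISS
    ([ISS_of_ULIM]).  The remaining implications only weaken an estimate, apart
    from UAG and BRS giving stability of the origin: there UAG controls all times
    after some tau, and up to time tau small initial states produce small
    trajectories by Gronwall's inequality ([flow_small_data]).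

    The proof of [ISS_of_ULIM] rests on a return argument
    ([bound_from_returns]).  If every trajectory that starts in a ball, with
    inputs below some level, satisfies a bound up to a time h and is back in the
    ball at some time between 1 and h, then the cocycle property makes the bound
    hold forever.  ULIM, applied at time 1, supplies the returns.  For local
    stability ([uniform_local_stability]) the ball comes from stability under the
    zero input, ULIM then fixes h, and only afterwards is the input level chosen
    so small that up to time h the trajectory stays near the undisturbed one
    ([flow_input_continuity]).  For boundedness ([uniform_boundedness]) the bound
    up to h is BRS.  These two facts give a class K estimate valid for all times
    ([uniform_gain]); restarting it at the time when ULIM makes the state small
    gives uniform attraction ([uniform_attraction]), and both together give
    a KL bound.

    Qualitative bounds become comparison functions through [KL_envelope]: values
    attached to a size a and a time t that are bounded for bounded a, small for
    small a, and small for large t at bounded a, lie below a KL function of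
    (a, t).  The envelope is a supremum of bumps, one per value, that share a
    Lipschitz constant away from a = 0; at a = 0 it is continuous because the
    values are small there.

    About the flow two things are needed.  The semigroup is bounded on bounded
    time intervals ([semigroup_bounded]), which is the uniform boundedness
    principle, proved here with nested balls.  Two mild solutions then satisfy an
    integral inequality for their distance ([mild_difference]), whence
    uniqueness, the cocycle property and the two continuity estimates above.  BRS
    confines all trajectories concerned to one ball beforehand, so that a single
    Lipschitz constant of f serves. *)

Set Implicit Arguments.
Unset Strict Implicit.
Unset Printing Implicit Defensive.

Open Scope R_scope.

(** * Comparison functions *)

Definition sup_of (E : R -> Prop) : R := real (Lub_Rbar E).

Lemma sup_of_ub (E : R -> Prop) (M z : R) :
  (forall y, E y -> y <= M) -> E z -> z <= sup_of E.
Proof.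
  intros hM hz. unfold sup_of.
  destruct (Lub_Rbar_correct E) as [hub hlub].
  specialize (hub z hz). specialize (hlub (Finite M) hM).
  destruct (Lub_Rbar E) as [l| |]; simpl in *; tauto.
Qed.

Lemma sup_of_lub (E : R -> Prop) (M z : R) :
  E z -> (forall y, E y -> y <= M) -> sup_of E <= M.
Proof.
  intros hz hM. unfold sup_of.
  destruct (Lub_Rbar_correct E) as [hub hlub].
  specialize (hub z hz). specialize (hlub (Finite M) hM).
  destruct (Lub_Rbar E) as [l| |]; simpl in *; tauto.
Qed.

Definition ramp (c : R) : R := Rmax 0 (Rmin 1 c).

Ltac ramp_cases :=
  unfold ramp, Rmax, Rmin in *; repeat destruct (Rle_dec _ _); try lra.

Lemma ramp_range c : 0 <= ramp c <= 1.
Proof. split; ramp_cases. Qed.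

Lemma ramp_le c d : c <= d -> ramp c <= ramp d.
Proof. intros h; ramp_cases. Qed.

Lemma ramp_one c : 1 <= c -> ramp c = 1.
Proof. intros h; ramp_cases. Qed.

Lemma ramp_zero c : c <= 0 -> ramp c = 0.
Proof. intros h; ramp_cases. Qed.

Lemma ramp_lipschitz c d : Rabs (ramp c - ramp d) <= Rabs (c - d).
Proof.
  destruct (Rle_dec c d) as [h|h].
  - rewrite (Rabs_left1 (c - d)) by lra.
    rewrite Rabs_left1; ramp_cases.
  - rewrite (Rabs_right (c - d)) by lra.
    rewrite Rabs_right; ramp_cases.
Qed.

(** The weight of a sample (a, tau, v) at the point (1/q, t): it equals v as soon
    as a <= 1/q and t <= tau, vanishes once a >= 2/q or t >= tau + 1, and is
    monotone and Lipschitz in q and t.  With 1/r as parameter in place of r, no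
    division enters the Lipschitz bound. *)
Definition bump (a tau v q t : R) : R :=
  v * ramp (2 - a * q) * ramp (1 + tau - t).

(** With 0 included, the set is nonempty and its supremum nonnegative. *)
Definition bump_values (P : R -> R -> R -> Prop) (q t z : R) : Prop :=
  z = 0 \/ exists a tau v, P a tau v /\ 0 <= v /\ z = bump a tau v q t.

Definition hull (P : R -> R -> R -> Prop) (q t : R) : R :=
  sup_of (bump_values P q t).

Lemma bump_le (a tau v q t K : R) : 0 <= K -> 0 <= v -> 0 < q ->
  (a <= 2 / q -> t - 1 <= tau -> v <= K) -> bump a tau v q t <= K.
Proof.
  intros hK hv hq h. unfold bump.
  destruct (ramp_range (2 - a * q)), (ramp_range (1 + tau - t)).
  destruct (Rle_dec a (2 / q)) as [ha|ha].
  - destruct (Rle_dec (t - 1) tau) as [ht|ht].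
    + specialize (h ha ht).
      apply Rle_trans with (v * 1 * 1); [|lra].
      repeat apply Rmult_le_compat; try lra.
      apply Rmult_le_pos; lra.
    + rewrite (@ramp_zero (1 + tau - t)) by lra. lra.
  - rewrite (@ramp_zero (2 - a * q)); [lra|].
    assert (2 / q * q <= a * q) by (apply Rmult_le_compat_r; lra).
    replace (2 / q * q) with 2 in * by (field; lra). lra.
Qed.

Lemma bump_lipschitz (a tau v q q' t t' A K : R) :
  0 <= a -> 0 <= v -> 0 <= A -> 0 < q -> 0 < q' -> 2 <= A * q -> 2 <= A * q' ->
  (a <= A -> v <= K) -> 0 <= K ->
  Rabs (bump a tau v q t - bump a tau v q' t') <=
    K * (A * Rabs (q - q') + Rabs (t - t')).
Proof.
  intros ha hv hA hq hq' h1 h2 hK hK0. unfold bump.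
  assert (hR : 0 <= A * Rabs (q - q') + Rabs (t - t')).
  { apply Rplus_le_le_0_compat; [apply Rmult_le_pos; [lra|]|]; apply Rabs_pos. }
  destruct (Rle_dec a A) as [hA'|hA'].
  - specialize (hK hA').
    set (x := ramp (2 - a * q)). set (x' := ramp (2 - a * q')).
    set (y := ramp (1 + tau - t)). set (y' := ramp (1 + tau - t')).
    assert (hx : Rabs (x - x') <= A * Rabs (q - q')).
    { eapply Rle_trans; [apply ramp_lipschitz|].
      replace (2 - a * q - (2 - a * q')) with (- (a * (q - q'))) by ring.
      rewrite Rabs_Ropp, Rabs_mult, (Rabs_pos_eq a) by lra.
      apply Rmult_le_compat_r; [apply Rabs_pos|lra]. }
    assert (hy : Rabs (y - y') <= Rabs (t - t')).
    { eapply Rle_trans; [apply ramp_lipschitz|].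
      replace (1 + tau - t - (1 + tau - t')) with (- (t - t')) by ring.
      rewrite Rabs_Ropp. lra. }
    assert (hx' : 0 <= x' <= 1) by apply ramp_range.
    assert (hy' : 0 <= y <= 1) by apply ramp_range.
    replace (v * x * y - v * x' * y')
      with (v * ((x - x') * y + x' * (y - y'))) by ring.
    rewrite Rabs_mult, (Rabs_pos_eq v) by lra.
    apply Rmult_le_compat; try lra; [apply Rabs_pos|].
    eapply Rle_trans; [apply Rabs_triang|].
    rewrite !Rabs_mult, (Rabs_pos_eq y), (Rabs_pos_eq x') by lra.
    pose proof (Rabs_pos (x - x')). pose proof (Rabs_pos (y - y')).
    apply Rplus_le_compat; nra.
  - rewrite (@ramp_zero (2 - a * q)) by nra.
    rewrite (@ramp_zero (2 - a * q')) by nra.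
    rewrite !Rmult_0_r, !Rmult_0_l, Rminus_0_r, Rabs_R0.
    apply Rmult_le_pos; lra.
Qed.

Lemma continuous_eps_delta (g : R -> R) (x e : R) : continuous g x -> 0 < e ->
  exists d, 0 < d /\ forall y, Rabs (y - x) < d -> Rabs (g y - g x) < e.
Proof.
  intros hg he.
  assert (h : locally (g x) (fun z => Rabs (z - g x) < e)).
  { exists (mkposreal e he). intros z hz. exact hz. }
  destruct (hg _ h) as [d hd]. exists d. split; [apply cond_pos|].
  intros y hy. apply hd. exact hy.
Qed.

Lemma exp_monotone x y : x <= y -> exp x <= exp y.
Proof.
  intros [h|h]; [left; apply exp_increasing; exact h|right; congruence].
Qed.

Section Hull.

Variable P : R -> R -> R -> Prop.
Hypothesis P_nonneg : forall a t v, P a t v -> 0 <= a /\ 0 <= t.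
Hypothesis P_bounded :
  forall r, exists K, forall a t v, P a t v -> a <= r -> v <= K.
Hypothesis P_small :
  forall e, 0 < e ->
    exists d, 0 < d /\ forall a t v, P a t v -> a <= d -> v <= e.
Hypothesis P_decay :
  forall e r, 0 < e -> 0 < r ->
    exists T, forall a t v, P a t v -> a <= r -> T <= t -> v <= e.

Lemma bump_values_bounded (q t : R) : 0 < q ->
  exists M, forall z, bump_values P q t z -> z <= M.
Proof.
  intros hq. destruct (P_bounded (2 / q)) as [K hK].
  exists (Rmax 0 K). intros z [hz|(a & tau & v & hP & hv & hz)]; subst z.
  - apply Rmax_l.
  - apply bump_le; auto; [apply Rmax_l|].
    intros ha _. eapply Rle_trans; [eapply hK; eauto|apply Rmax_r].
Qed.

Lemma hull_ge (q t z : R) : 0 < q -> bump_values P q t z -> z <= hull P q t.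
Proof.
  intros hq hz. destruct (bump_values_bounded t hq) as [M hM].
  eapply sup_of_ub; eauto.
Qed.

Lemma hull_le (q t M : R) : 0 < q ->
  (forall z, bump_values P q t z -> z <= M) -> hull P q t <= M.
Proof.
  intros hq hM. apply sup_of_lub with 0; [left; reflexivity|exact hM].
Qed.

Lemma hull_nonneg (q t : R) : 0 < q -> 0 <= hull P q t.
Proof. intros hq. apply hull_ge; [exact hq|left; reflexivity]. Qed.

Lemma hull_monotone (q q' t t' : R) : 0 < q' -> q' <= q -> t' <= t ->
  hull P q t <= hull P q' t'.
Proof.
  intros hq' hq ht. apply hull_le; [lra|].
  intros z [hz|(a & tau & v & hP & hv & hz)]; subst z.
  - apply hull_nonneg; exact hq'.
  - apply Rle_trans with (bump a tau v q' t').
    + destruct (P_nonneg hP). unfold bump.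
      destruct (ramp_range (2 - a * q)), (ramp_range (1 + tau - t)).
      apply Rmult_le_compat; try lra.
      * apply Rmult_le_pos; lra.
      * apply Rmult_le_compat_l; [lra|]. apply ramp_le. nra.
      * apply ramp_le. lra.
    + apply hull_ge; [exact hq'|]. right. exists a, tau, v. auto.
Qed.

Lemma hull_bound (q t K : R) : 0 < q -> 0 <= K ->
  (forall a tau v, P a tau v -> a <= 2 / q -> t - 1 <= tau -> v <= K) ->
  hull P q t <= K.
Proof.
  intros hq hK h. apply hull_le; [exact hq|].
  intros z [hz|(a & tau & v & hP & hv & hz)]; subst z; [exact hK|].
  apply bump_le; eauto.
Qed.

Lemma hull_le_add (q q' t t' e : R) : 0 < q -> 0 < q' -> 0 <= e ->
  (forall a tau v, P a tau v -> 0 <= v ->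
    bump a tau v q t <= bump a tau v q' t' + e) ->
  hull P q t <= hull P q' t' + e.
Proof.
  intros hq hq' he h. apply hull_le; [exact hq|].
  intros z [hz|(a & tau & v & hP & hv & hz)]; subst z.
  - pose proof (hull_nonneg t' hq'). lra.
  - eapply Rle_trans; [apply h; auto|]. apply Rplus_le_compat_r.
    apply hull_ge; [exact hq'|]. right. exists a, tau, v. auto.
Qed.

(** A bump that does not vanish for some q >= q0 has a <= 2/q0, so all relevant
    bumps share the bound on v over that range and hence a Lipschitz constant,
    which the supremum inherits. *)
Lemma hull_locally_lipschitz (q0 : R) : 0 < q0 ->
  exists C, 0 < C /\ forall q q' t t', q0 <= q -> q0 <= q' ->
    Rabs (hull P q t - hull P q' t') <= C * (Rabs (q - q') + Rabs (t - t')).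
Proof.
  intros hq0. set (A := 2 / q0).
  assert (hA : 0 < A) by (apply Rdiv_lt_0_compat; lra).
  assert (hAq : forall q, q0 <= q -> 2 <= A * q).
  { intros q hq. replace 2 with (A * q0) by (unfold A; field; lra).
    apply Rmult_le_compat_l; lra. }
  destruct (P_bounded A) as [K0 hK0]. set (K := Rmax 0 K0).
  assert (hK : 0 <= K) by apply Rmax_l.
  exists (K * (A + 1) + 1). split; [nra|].
  assert (main : forall q q' t t', q0 <= q -> q0 <= q' ->
    hull P q t <=
      hull P q' t' + (K * (A + 1) + 1) * (Rabs (q - q') + Rabs (t - t'))).
  { intros q q' t t' hq hq'.
    pose proof (Rabs_pos (q - q')). pose proof (Rabs_pos (t - t')).
    apply hull_le_add; try lra; [apply Rmult_le_pos; nra|].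
    intros a tau v hP hv. destruct (P_nonneg hP) as [ha _].
    assert (h : Rabs (bump a tau v q t - bump a tau v q' t') <=
       K * (A * Rabs (q - q') + Rabs (t - t'))).
    { apply bump_lipschitz; auto; try lra.
      intros hle. eapply Rle_trans; [eapply hK0; eauto|apply Rmax_r]. }
    apply Rabs_le_between in h.
    assert (K * (A * Rabs (q - q') + Rabs (t - t')) <=
       (K * (A + 1) + 1) * (Rabs (q - q') + Rabs (t - t'))).
    { assert (0 <= K * Rabs (q - q')) by nra.
      assert (0 <= K * A) by nra.
      assert (0 <= K * A * Rabs (t - t')) by nra. nra. }
    lra. }
  intros q q' t t' hq hq'. apply Rabs_le. split.
  - pose proof (main q' q t' t hq' hq) as h.
    rewrite (Rabs_minus_sym q' q), (Rabs_minus_sym t' t) in h. lra.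
  - pose proof (main q q' t t' hq hq') as h. lra.
Qed.

(** The summand r e^(-t) makes the monotonicity in both arguments strict. *)
Definition KL_hull (r t : R) : R :=
  (if Rle_dec r 0 then 0 else hull P (/ r) t) + r * exp (- t).

Lemma KL_hull_ge (a t v : R) : P a t v -> v <= KL_hull a t.
Proof.
  intros hP. destruct (P_nonneg hP) as [ha ht]. unfold KL_hull.
  pose proof (exp_pos (- t)).
  destruct (Rle_dec a 0) as [ha0|ha0].
  - replace a with 0 in * by lra. rewrite Rmult_0_l, Rplus_0_l.
    apply le_epsilon. intros e he. destruct (P_small he) as [d [hd h]].
    rewrite Rplus_0_l. eapply h; eauto. lra.
  - assert (hi : 0 < / a) by (apply Rinv_0_lt_compat; lra).
    assert (0 <= a * exp (- t)) by nra.
    destruct (Rle_dec v 0) as [hv|hv].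
    + pose proof (hull_nonneg t hi). lra.
    + assert (v <= hull P (/ a) t); [|lra].
      apply hull_ge; [exact hi|]. right. exists a, t, v.
      repeat split; auto; [lra|]. unfold bump.
      rewrite !ramp_one; [ring|lra|]. rewrite Rinv_r; lra.
Qed.

Lemma KL_hull_small (e : R) : 0 < e ->
  exists d, 0 < d /\ forall r t, 0 <= r < d -> 0 <= t -> 0 <= KL_hull r t <= e.
Proof.
  intros he. assert (he2 : 0 < e / 2) by lra.
  destruct (P_small he2) as [d [hd h]].
  exists (Rmin (d / 2) (e / 2)). split; [apply Rmin_pos; lra|].
  intros r t hr ht.
  assert (hr1 : r < d / 2) by (eapply Rlt_le_trans; [apply hr|apply Rmin_l]).
  assert (hr2 : r < e / 2) by (eapply Rlt_le_trans; [apply hr|apply Rmin_r]).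
  assert (hexp : 0 < exp (- t) <= 1).
  { split; [apply exp_pos|]. rewrite <- exp_0. apply exp_monotone. lra. }
  assert (0 <= r * exp (- t) <= e / 2) by nra.
  unfold KL_hull. destruct (Rle_dec r 0) as [h0|h0]; [lra|].
  assert (hi : 0 < / r) by (apply Rinv_0_lt_compat; lra).
  pose proof (hull_nonneg t hi).
  assert (hull P (/ r) t <= e / 2); [|lra].
  apply hull_bound; try lra. intros a tau v hP ha _. eapply h; eauto.
  replace (2 / / r) with (2 * r) in ha by (field; lra). lra.
Qed.

Lemma KL_hull_continuous (r t e : R) : 0 <= r -> 0 <= t -> 0 < e ->
  exists d, 0 < d /\ forall r' t', 0 <= r' -> 0 <= t' ->
    Rabs (r' - r) < d -> Rabs (t' - t) < d ->
    Rabs (KL_hull r' t' - KL_hull r t) < e.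
Proof.
  intros hr ht he. destruct (Rle_lt_or_eq_dec _ _ hr) as [hr0|hr0].
  - set (q0 := / (2 * r)).
    assert (hq0 : 0 < q0) by (apply Rinv_0_lt_compat; lra).
    destruct (hull_locally_lipschitz hq0) as [C [hC hlip]].
    assert (c1 : continuous Rinv r).
    { apply continuity_pt_filterlim, continuity_pt_inv; [|lra].
      apply derivable_continuous, derivable_id. }
    assert (c2 : continuous (fun s => exp (- s)) t).
    { apply (ex_derive_continuous (fun s => exp (- s)) t). auto_derive. exact I. }
    assert (he1 : 0 < e / (4 * C)) by (apply Rdiv_lt_0_compat; lra).
    assert (he2 : 0 < e / (4 * r)) by (apply Rdiv_lt_0_compat; lra).
    destruct (continuous_eps_delta c1 he1) as [d1 [hd1 h1]].
    destruct (continuous_eps_delta c2 he2) as [d2 [hd2 h2]].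
    set (d := Rmin (Rmin d1 d2) (Rmin (Rmin (e / 4) (r / 2)) (e / (4 * C)))).
    exists d. split; [unfold d; repeat apply Rmin_pos; lra|].
    intros r' t' hr' ht' hdr hdt.
    assert (hd : d <= d1 /\ d <= d2 /\ d <= e / 4 /\ d <= r / 2 /\ d <= e / (4 * C)).
    { unfold d, Rmin. repeat destruct (Rle_dec _ _); lra. }
    destruct hd as (b1 & b2 & b3 & b4 & b5).
    assert (hr'' : r / 2 < r' < 2 * r) by (apply Rabs_lt_between in hdr; lra).
    specialize (h1 r' (Rlt_le_trans _ _ _ hdr b1)).
    specialize (h2 t' (Rlt_le_trans _ _ _ hdt b2)). simpl in h1, h2.
    unfold KL_hull.
    destruct (Rle_dec r' 0) as [h|_]; [lra|].
    destruct (Rle_dec r 0) as [h|_]; [lra|].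
    assert (hq1 : q0 <= / r') by (apply Rinv_le_contravar; lra).
    assert (hq2 : q0 <= / r) by (apply Rinv_le_contravar; lra).
    specialize (hlip (/ r') (/ r) t' t hq1 hq2).
    assert (s1 : C * (Rabs (/ r' - / r) + Rabs (t' - t)) < e / 2).
    { replace (e / 2) with (C * (e / (4 * C) + e / (4 * C))) by (field; lra).
      apply Rmult_lt_compat_l; lra. }
    assert (s2 : Rabs (r' * exp (- t') - r * exp (- t)) < e / 2).
    { replace (r' * exp (- t') - r * exp (- t))
        with ((r' - r) * exp (- t') + r * (exp (- t') - exp (- t))) by ring.
      eapply Rle_lt_trans; [apply Rabs_triang|]. rewrite !Rabs_mult.
      rewrite (Rabs_pos_eq r) by lra.
      assert (hexp : 0 < exp (- t') <= 1).
      { split; [apply exp_pos|]. rewrite <- exp_0. apply exp_monotone. lra. }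
      rewrite (Rabs_pos_eq (exp (- t'))) by lra.
      pose proof (Rabs_pos (r' - r)).
      assert (r * Rabs (exp (- t') - exp (- t)) < e / 4).
      { replace (e / 4) with (r * (e / (4 * r))) by (field; lra).
        apply Rmult_lt_compat_l; lra. }
      nra. }
    replace (hull P (/ r') t' + r' * exp (- t') - (hull P (/ r) t + r * exp (- t)))
      with ((hull P (/ r') t' - hull P (/ r) t)
            + (r' * exp (- t') - r * exp (- t))) by ring.
    eapply Rle_lt_trans; [apply Rabs_triang|]. lra.
  - subst r. assert (he2 : 0 < e / 2) by lra.
    destruct (KL_hull_small he2) as [d [hd h]].
    exists d. split; [exact hd|]. intros r' t' hr' ht' hdr _.
    rewrite Rminus_0_r, Rabs_pos_eq in hdr by lra.
    assert (h0 : 0 <= 0 < d) by lra. pose proof (h 0 t h0 ht).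
    assert (h1 : 0 <= r' < d) by lra. pose proof (h r' t' h1 ht').
    apply Rabs_def1; lra.
Qed.

Lemma KL_hull_increasing (r s t : R) : 0 <= r -> r < s ->
  KL_hull r t < KL_hull s t.
Proof.
  intros hr hs. unfold KL_hull. pose proof (exp_pos (- t)).
  destruct (Rle_dec s 0) as [h|_]; [lra|].
  assert (hi : 0 < / s) by (apply Rinv_0_lt_compat; lra).
  assert (r * exp (- t) < s * exp (- t)) by (apply Rmult_lt_compat_r; lra).
  destruct (Rle_dec r 0) as [h|h].
  - pose proof (hull_nonneg t hi). lra.
  - assert (hull P (/ r) t <= hull P (/ s) t); [|lra].
    apply hull_monotone; [exact hi| |lra]. apply Rinv_le_contravar; lra.
Qed.

Lemma KL_hull_decreasing (r t t' : R) : 0 < r -> t < t' ->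
  KL_hull r t' < KL_hull r t.
Proof.
  intros hr ht. unfold KL_hull.
  destruct (Rle_dec r 0) as [h|_]; [lra|].
  assert (hi : 0 < / r) by (apply Rinv_0_lt_compat; lra).
  assert (exp (- t') < exp (- t)) by (apply exp_increasing; lra).
  assert (hull P (/ r) t' <= hull P (/ r) t)
    by (apply hull_monotone; lra).
  nra.
Qed.

Lemma KL_hull_vanishes (r e : R) : 0 < r -> 0 < e ->
  exists T, forall t, T <= t -> 0 <= KL_hull r t <= e.
Proof.
  intros hr he. assert (he2 : 0 < e / 2) by lra.
  assert (hr2 : 0 < 2 * r) by lra.
  destruct (P_decay he2 hr2) as [T hT].
  exists (Rmax (T + 1) (- ln (e / (2 * r)))). intros t ht.
  assert (ht1 : T + 1 <= t) by (eapply Rle_trans; [apply Rmax_l|exact ht]).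
  assert (ht2 : - ln (e / (2 * r)) <= t)
    by (eapply Rle_trans; [apply Rmax_r|exact ht]).
  assert (hpos : 0 < e / (2 * r)) by (apply Rdiv_lt_0_compat; lra).
  assert (hexp : exp (- t) <= e / (2 * r)).
  { rewrite <- (exp_ln (e / (2 * r))) by lra. apply exp_monotone. lra. }
  assert (r * exp (- t) <= e / 2).
  { replace (e / 2) with (r * (e / (2 * r))) by (field; lra).
    apply Rmult_le_compat_l; lra. }
  assert (hi : 0 < / r) by (apply Rinv_0_lt_compat; lra).
  pose proof (exp_pos (- t)). pose proof (hull_nonneg t hi).
  assert (hull P (/ r) t <= e / 2).
  { apply hull_bound; try lra. intros a tau v hP ha htau.
    replace (2 / / r) with (2 * r) in ha by (field; lra).
    eapply hT; eauto. lra. }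
  unfold KL_hull. destruct (Rle_dec r 0); [lra|]. nra.
Qed.

End Hull.

Lemma continuous_on_Rplus (g : R -> R) :
  (forall x e, 0 <= x -> 0 < e -> exists d, 0 < d /\
     forall y, 0 <= y -> Rabs (y - x) < d -> Rabs (g y - g x) < e) ->
  continuous_on Rplus_set g.
Proof.
  intros h x hx Q [e he]. destruct (h x e hx (cond_pos e)) as [d [hd hd']].
  exists (mkposreal d hd). intros y hy hy0. apply he. apply hd'; assumption.
Qed.

Lemma continuous_on_Rplus_eps (g : R -> R) (x e : R) :
  continuous_on Rplus_set g -> 0 <= x -> 0 < e -> exists d, 0 < d /\
     forall y, 0 <= y -> Rabs (y - x) < d -> Rabs (g y - g x) < e.
Proof.
  intros hg hx he.
  assert (h : locally (g x) (fun z => Rabs (z - g x) < e)).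
  { exists (mkposreal e he). intros z hz. exact hz. }
  destruct (hg x hx _ h) as [d hd]. exists d. split; [apply cond_pos|].
  intros y hy0 hy. apply hd; [exact hy|exact hy0].
Qed.

(** The passage from epsilon-delta statements about trajectories to comparison
    functions; P a t v reads: the value v occurs at size a and time t. *)
Lemma KL_envelope (P : R -> R -> R -> Prop) :
  (forall a t v, P a t v -> 0 <= a /\ 0 <= t) ->
  (forall r, exists K, forall a t v, P a t v -> a <= r -> v <= K) ->
  (forall e, 0 < e ->
    exists d, 0 < d /\ forall a t v, P a t v -> a <= d -> v <= e) ->
  (forall e r, 0 < e -> 0 < r ->
    exists T, forall a t v, P a t v -> a <= r -> T <= t -> v <= e) ->
  exists beta, class_KL beta /\ forall a t v, P a t v -> v <= beta a t.
Proof.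
  intros h0 hb hs hd. exists (KL_hull P).
  assert (hc := KL_hull_continuous h0 hb hs).
  split; [split; [|split]|].
  - intros [r t] [hr ht] Q [e he]. simpl in hr, ht.
    destruct (hc r t e hr ht (cond_pos e)) as [d [hd0 hd']].
    exists (mkposreal d hd0). intros [r' t'] [h1 h2] [hr' ht'].
    apply he. apply hd'; assumption.
  - intros t ht. split; [|split].
    + apply continuous_on_Rplus. intros r e hr he.
      destruct (hc r t e hr ht he) as [d [hd0 hd']]. exists d.
      split; [exact hd0|]. intros r' hr' h. apply hd'; auto.
      rewrite Rminus_eq_0, Rabs_R0. exact hd0.
    + intros r s hr hlt. apply KL_hull_increasing; auto.
    + unfold KL_hull. destruct (Rle_dec 0 0); lra.
  - intros r hr. assert (hr' : 0 <= r) by lra. split; [|split].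
    + apply continuous_on_Rplus. intros t e ht he.
      destruct (hc r t e hr' ht he) as [d [hd0 hd']]. exists d.
      split; [exact hd0|]. intros t' ht' h. apply hd'; auto.
      rewrite Rminus_eq_0, Rabs_R0. exact hd0.
    + intros s t hs' hlt. apply KL_hull_decreasing; auto.
    + apply is_lim_spec. intros e.
      assert (he2 : 0 < e / 2) by (pose proof (cond_pos e); lra).
      destruct (KL_hull_vanishes hb hd hr he2) as [T hT].
      exists T. intros t ht. specialize (hT t (Rlt_le _ _ ht)).
      pose proof (cond_pos e). rewrite Rminus_0_r. apply Rabs_def1; lra.
  - intros a t v hP. eapply KL_hull_ge; eauto.
Qed.

Lemma class_K_nonneg (g : R -> R) (r : R) : class_K g -> 0 <= r -> 0 <= g r.
Proof.
  intros (_ & hm & h0) hr. destruct (Rle_lt_or_eq_dec _ _ hr) as [h|h].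
  - specialize (hm 0 r (Rle_refl _) h). lra.
  - subst r. lra.
Qed.

Lemma class_K_le (g : R -> R) (r s : R) : class_K g -> 0 <= r -> r <= s ->
  g r <= g s.
Proof.
  intros (_ & hm & _) hr hs. destruct (Rle_lt_or_eq_dec _ _ hs) as [h|h].
  - left. apply hm; assumption.
  - subst s. lra.
Qed.

Lemma class_K_small (g : R -> R) (e : R) : class_K g -> 0 < e ->
  exists d, 0 < d /\ g d <= e.
Proof.
  intros (hc & hm & h0) he.
  destruct (continuous_on_Rplus_eps hc (Rle_refl 0) he) as [d [hd h]].
  exists (d / 2). split; [lra|].
  assert (hy : Rabs (d / 2 - 0) < d) by (rewrite Rabs_pos_eq; lra).
  assert (hd2 : 0 <= d / 2) by lra. specialize (h _ hd2 hy).
  apply Rabs_def2 in h. lra.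
Qed.

Lemma class_K_id : class_K (fun r => r).
Proof.
  split; [|split]; try tauto.
  apply continuous_on_Rplus. intros x e _ he. exists e. tauto.
Qed.

Lemma class_K_plus (g h : R -> R) : class_K g -> class_K h ->
  class_K (fun r => g r + h r).
Proof.
  intros (hc & hm & h0) (hc' & hm' & h0'). split; [|split].
  - apply continuous_on_Rplus. intros x e hx he.
    assert (he2 : 0 < e / 2) by lra.
    destruct (continuous_on_Rplus_eps hc hx he2) as [d [hd k]].
    destruct (continuous_on_Rplus_eps hc' hx he2) as [d' [hd' k']].
    exists (Rmin d d'). split; [apply Rmin_pos; lra|].
    intros y hy hlt.
    specialize (k y hy (Rlt_le_trans _ _ _ hlt (Rmin_l _ _))).
    specialize (k' y hy (Rlt_le_trans _ _ _ hlt (Rmin_r _ _))).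
    replace (g y + h y - (g x + h x)) with ((g y - g x) + (h y - h x)) by ring.
    eapply Rle_lt_trans; [apply Rabs_triang|]. lra.
  - intros r s hr hlt. specialize (hm r s hr hlt). specialize (hm' r s hr hlt). lra.
  - lra.
Qed.

Lemma class_K_add_id (g : R -> R) : class_K g ->
  class_Kinf (fun r => g r + r).
Proof.
  intros hg. split; [exact (class_K_plus hg class_K_id)|].
  intros M. exists (Rmax 0 M + 1).
  assert (0 <= Rmax 0 M) by apply Rmax_l.
  assert (M <= Rmax 0 M) by apply Rmax_r.
  assert (0 <= g (Rmax 0 M + 1)) by (apply class_K_nonneg; auto; lra). lra.
Qed.

Lemma class_K_comp (g h : R -> R) : class_K g -> class_K h ->
  class_K (fun r => g (h r)).
Proof.
  intros hg hh. pose proof hg as (hc & hm & h0).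
  pose proof hh as (hc' & hm' & h0'). split; [|split].
  - apply continuous_on_Rplus. intros x e hx he.
    destruct (continuous_on_Rplus_eps hc (class_K_nonneg hh hx) he) as [d [hd k]].
    destruct (continuous_on_Rplus_eps hc' hx hd) as [d' [hd' k']].
    exists d'. split; [exact hd'|]. intros y hy hlt.
    apply k; [apply class_K_nonneg; auto|]. apply k'; auto.
  - intros r s hr hlt. apply hm; [apply class_K_nonneg; auto|auto].
  - rewrite h0'. exact h0.
Qed.

(** A family without time is a family concentrated at time 0, for which the decay
    condition is empty. *)
Lemma class_K_envelope (P : R -> R -> Prop) :
  (forall a v, P a v -> 0 <= a) ->
  (forall r, exists K, forall a v, P a v -> a <= r -> v <= K) ->
  (forall e, 0 < e ->
    exists d, 0 < d /\ forall a v, P a v -> a <= d -> v <= e) ->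
  exists sigma, class_K sigma /\ forall a v, P a v -> v <= sigma a.
Proof.
  intros h0 hb hs.
  destruct (KL_envelope (P := fun a t v => P a v /\ t = 0)) as [beta [hbeta h]].
  - intros a t v [hP ->]. split; [eapply h0; eauto|lra].
  - intros r. destruct (hb r) as [K hK]. exists K.
    intros a t v [hP _]. eauto.
  - intros e he. destruct (hs e he) as [d [hd k]]. exists d.
    split; [exact hd|]. intros a t v [hP _]. eauto.
  - intros e r _ _. exists 1. intros a t v [_ ->]. lra.
  - exists (fun r => beta r 0). split; [apply hbeta; lra|].
    intros a v hP. apply h. auto.
Qed.

(** * Strongly continuous semigroups *)

Section GroupFacts.

Variable V : AbelianGroup.

Lemma plus_minus_cancel (x y : V) : plus x (minus y x) = y.
Proof.
  unfold minus. etransitivity; [apply f_equal, plus_comm|].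
  etransitivity; [apply plus_assoc|].
  transitivity (plus zero y); [|apply plus_zero_l].
  apply (f_equal (fun z => plus z y)), plus_opp_r.
Qed.

Lemma minus_plus_cancel (x y : V) : minus (plus x y) x = y.
Proof.
  unfold minus. etransitivity; [symmetry; apply plus_assoc|].
  apply (plus_minus_cancel x y).
Qed.

Lemma minus_plus_plus (a b c d : V) :
  minus (plus a b) (plus c d) = plus (minus a c) (minus b d).
Proof.
  unfold minus. transitivity (plus (plus a b) (plus (opp c) (opp d))).
  { apply f_equal, opp_plus. }
  etransitivity; [symmetry; apply plus_assoc|].
  etransitivity; [|apply plus_assoc]. apply f_equal.
  etransitivity; [apply plus_assoc|].
  etransitivity; [|symmetry; apply plus_assoc].
  apply (f_equal (fun z => plus z (opp d))), plus_comm.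
Qed.

Lemma plus_minus_minus (x y : V) : minus (plus x y) (minus x y) = plus y y.
Proof.
  unfold minus at 2. etransitivity; [apply minus_plus_plus|].
  transitivity (plus zero (minus y (opp y))).
  { apply (f_equal (fun z => plus z (minus y (opp y)))), minus_eq_zero. }
  etransitivity; [apply plus_zero_l|]. apply (f_equal (plus y)), opp_opp.
Qed.

End GroupFacts.

Section NormFacts.

Variable V : NormedModule R_AbsRing.

(** A name for the distance lets a single inferred structure occur in all
    distance terms over a given space. *)
Definition ndist (x y : V) : R := norm (minus x y).

Lemma ndist_ge_0 (x y : V) : 0 <= ndist x y.
Proof. apply norm_ge_0. Qed.

Lemma ndist_refl (x : V) : ndist x x = 0.
Proof. unfold ndist. rewrite minus_eq_zero. apply norm_zero. Qed.

Lemma ndist_sym (x y : V) : ndist x y = ndist y x.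
Proof. unfold ndist. rewrite <- (opp_minus y x). apply norm_opp. Qed.

Lemma ndist_triangle (x y z : V) : ndist x z <= ndist x y + ndist y z.
Proof. unfold ndist. rewrite (minus_trans y x z). apply norm_triangle. Qed.

Lemma norm_le_ndist (x y : V) : norm x <= norm y + ndist x y.
Proof.
  pose proof (norm_triangle_inv x y) as h.
  apply Rabs_le_between in h. unfold ndist. lra.
Qed.

Lemma ndist_zero_r (x : V) : ndist x zero = norm x.
Proof. unfold ndist. f_equal. exact (minus_zero_r (x : AbelianGroup.sort V)). Qed.

Lemma ndist_plus_l (x y : V) : ndist (plus x y) x = norm y.
Proof. unfold ndist. f_equal. apply minus_plus_cancel. Qed.

Lemma ndist_minus_l (x y : V) : ndist (minus x y) x = norm y.
Proof. unfold minus. rewrite ndist_plus_l. apply norm_opp. Qed.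

Lemma ndist_plus_plus (a b c d : V) :
  ndist (plus a b) (plus c d) <= ndist a c + ndist b d.
Proof.
  unfold ndist. eapply Rle_trans; [|apply norm_triangle].
  right. f_equal. apply minus_plus_plus.
Qed.

Lemma ball_of_ndist (x y : V) (e : R) : ndist y x < e -> ball x e y.
Proof. exact (@norm_compat1 R_AbsRing V x y e). Qed.

Lemma locally_ndist (x : V) (e : R) : 0 < e ->
  locally x (fun y => ndist y x < e).
Proof.
  intros he. apply (@locally_le_locally_norm R_AbsRing V).
  exists (mkposreal e he). intros y hy. exact hy.
Qed.

Lemma ndist_eq_0 (x y : V) : ndist x y <= 0 -> x = y.
Proof.
  intros h. pose proof (ndist_ge_0 x y).
  assert (hz : minus x y = zero) by (apply norm_eq_zero; unfold ndist in *; lra).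
  rewrite <- (plus_minus_cancel y x), hz. apply plus_zero_r.
Qed.

Lemma norm_scal_le (c : R) (x : V) : norm (scal c x) <= Rabs c * norm x.
Proof. exact (norm_scal c x). Qed.

Lemma norm_scal_ge (c : R) (x : V) : 0 < c -> c * norm x <= norm (scal c x).
Proof.
  intros hc. apply Rmult_le_reg_l with (/ c); [apply Rinv_0_lt_compat, hc|].
  replace (/ c * (c * norm x)) with (norm x) by (field; lra).
  apply Rle_trans with (norm (scal (/ c) (scal c x))).
  - rewrite scal_assoc.
    replace (mult (/ c) c) with (one : R_AbsRing)
      by (unfold mult, one; simpl; field; lra).
    rewrite scal_one. apply Rle_refl.
  - eapply Rle_trans; [apply norm_scal_le|].
    rewrite Rabs_pos_eq; [lra|]. left. apply Rinv_0_lt_compat, hc.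
Qed.

(** Twice y is the difference of x + y and x - y. *)
Lemma norm_plus_or_minus (x y : V) :
  norm y <= norm (plus x y) \/ norm y <= norm (minus x y).
Proof.
  assert (h : norm (scal 2 y) <= norm (plus x y) + norm (minus x y)).
  { replace (scal 2 y) with (minus (plus x y) (minus x y)).
    - unfold minus at 1. eapply Rle_trans; [apply norm_triangle|].
      rewrite norm_opp. lra.
    - etransitivity; [apply plus_minus_minus|].
      replace 2 with (plus one one : R_AbsRing)
        by (unfold plus, one; simpl; ring).
      rewrite scal_distr_r, scal_one. reflexivity. }
  pose proof (@norm_scal_ge 2 y Rlt_0_2).
  destruct (Rle_dec (norm y) (norm (plus x y))); [now left|right; lra].
Qed.

End NormFacts.

Lemma is_linear_minus (V W : NormedModule R_AbsRing) (l : V -> W) (x y : V) :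
  is_linear l -> l (minus x y) = minus (l x) (l y).
Proof.
  intros hl. unfold minus.
  etransitivity; [apply (linear_plus _ hl)|]. apply (f_equal (plus (l x))).
  transitivity (l (scal (opp (one : R_AbsRing)) y)).
  - apply f_equal. symmetry. apply (scal_opp_one (K := R_AbsRing) y).
  - etransitivity; [apply (linear_scal _ hl)|].
    apply (scal_opp_one (K := R_AbsRing) (l y)).
Qed.

Lemma is_linear_ndist (V W : NormedModule R_AbsRing) (l : V -> W) (M : R) :
  is_linear l -> (forall v, norm (l v) <= M * norm v) ->
  forall x y, ndist (l x) (l y) <= M * ndist x y.
Proof.
  intros hl hM x y. unfold ndist. rewrite <- (is_linear_minus x y hl). apply hM.
Qed.

Lemma is_linear_plus_or_minus (V W : NormedModule R_AbsRing) (l : V -> W)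
    (x y : V) : is_linear l ->
  norm (l y) <= norm (l (plus x y)) \/ norm (l y) <= norm (l (minus x y)).
Proof.
  intros hl. rewrite (is_linear_minus x y hl), (linear_plus _ hl x y).
  apply norm_plus_or_minus.
Qed.

Lemma is_linear_scaled (V W : NormedModule R_AbsRing) (l : V -> W) (K c : R) :
  is_linear l -> 0 < c -> (exists v, K * norm v < norm (l v)) ->
  exists w, norm w <= c /\ K * c <= norm (l w).
Proof.
  intros hl hc [v hv].
  assert (hv0 : 0 < norm v).
  { destruct (norm_ge_0 v) as [h|h]; [exact h|exfalso].
    assert (v = zero) by (apply norm_eq_zero; symmetry; exact h).
    subst v. rewrite (linear_zero _ hl), !norm_zero in hv. lra. }
  assert (hq : 0 < c / norm v) by (apply Rdiv_lt_0_compat; lra).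
  exists (scal (c / norm v) v). split.
  - eapply Rle_trans; [apply norm_scal_le|].
    rewrite Rabs_pos_eq by lra. right. field. lra.
  - rewrite (linear_scal _ hl).
    eapply Rle_trans; [|apply norm_scal_ge; exact hq].
    replace (K * c) with (c / norm v * (K * norm v)) by (field; lra).
    apply Rmult_le_compat_l; lra.
Qed.

Lemma complete_norm_limit (X : CompleteNormedModule R_AbsRing)
    (s : nat -> X) (r : nat -> R) :
  (forall k j, (k <= j)%nat -> ndist (s j) (s k) <= r k) ->
  (forall e, 0 < e -> exists k, r k < e) ->
  exists l : X, forall k, ndist l (s k) <= r k.
Proof.
  intros hs hr. set (F := filtermap s eventually).
  assert (hF : ProperFilter F).
  { apply filtermap_proper_filter, eventually_filter. }
  assert (hc : cauchy F).
  { intros e. destruct (hr e (cond_pos e)) as [k hk]. exists (s k).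
    exists k. intros j hj. apply ball_of_ndist.
    eapply Rle_lt_trans; [apply hs; exact hj|exact hk]. }
  exists (lim F). intros k. apply le_epsilon. intros e he.
  pose proof (@norm_factor_gt_0 R_AbsRing X) as hnf.
  set (nf := @norm_factor R_AbsRing X) in *.
  assert (he' : 0 < e / nf) by (apply Rdiv_lt_0_compat; lra).
  destruct (complete_cauchy F hF hc (mkposreal _ he')) as [n hn].
  specialize (hn (max n k) (PeanoNat.Nat.le_max_l n k)).
  assert (hn' : ndist (s (max n k)) (lim F) < nf * (e / nf))
    by exact (norm_compat2 _ _ _ hn).
  replace (nf * (e / nf)) with e in hn' by (field; lra).
  pose proof (hs k (max n k) (PeanoNat.Nat.le_max_r n k)) as h.
  pose proof (ndist_triangle (lim F) (s (max n k)) (s k)).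
  rewrite ndist_sym in hn'. lra.
Qed.

Section Semigroup.

Variable X : CompleteNormedModule R_AbsRing.
Variable T : R -> X -> X.
Hypothesis hT : C0_semigroup T.

(** If no K bounds T up to time d, then some T t exceeds any prescribed level k at
    a point near x: for w of norm r/2 with T t w large, one of x + w and x - w
    will do.  By continuity of T t the level is exceeded on a whole ball. *)
Lemma unbounded_escape (k : R) (x : X) (r d : R) : 0 <= k -> 0 < r ->
  (forall K, 1 <= K -> exists t v, 0 <= t <= d /\ K * norm v < norm (T t v)) ->
  exists y r' t, 0 < r' /\ r' <= r / 2 /\ ndist y x <= r / 2 /\
    0 <= t <= d /\ forall z, ndist z y <= r' -> k < norm (T t z).
Proof.
  intros hk hr h.
  set (K := Rmax 1 ((k + 1) / (r / 2))).
  destruct (h K (Rmax_l _ _)) as (t & v & ht & hv).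
  assert (hl : is_linear (T t)) by (apply hT; lra).
  assert (hr2 : 0 < r / 2) by lra.
  destruct (is_linear_scaled hl hr2 (ex_intro _ v hv)) as (w & hw & hTw).
  assert (hkw : k + 1 <= norm (T t w)).
  { eapply Rle_trans; [|exact hTw].
    replace (k + 1) with ((k + 1) / (r / 2) * (r / 2)) by (field; lra).
    apply Rmult_le_compat_r; [lra|apply Rmax_r]. }
  assert (hy : exists y, ndist y x <= r / 2 /\ k + 1 <= norm (T t y)).
  { destruct (is_linear_plus_or_minus x w hl) as [h1|h1].
    - eexists. split; [|exact (Rle_trans _ _ _ hkw h1)].
      rewrite ndist_plus_l. exact hw.
    - eexists. split; [|exact (Rle_trans _ _ _ hkw h1)].
      rewrite ndist_minus_l. exact hw. }
  destruct hy as (y & hyx & hTy).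
  destruct (linear_norm _ hl) as (M & hM & hMb).
  exists y, (Rmin (r / 2) (/ (2 * M))), t.
  assert (hi : 0 < / (2 * M)) by (apply Rinv_0_lt_compat; lra).
  repeat split; try tauto.
  - apply Rmin_pos; lra.
  - apply Rmin_l.
  - intros z hz.
    pose proof (norm_le_ndist (T t y) (T t z)) as h1.
    pose proof (is_linear_ndist hl hMb y z) as h2. rewrite (ndist_sym y) in h2.
    assert (h3 : ndist z y <= / (2 * M))
      by (eapply Rle_trans; [exact hz|apply Rmin_r]).
    assert (h4 : M * ndist z y <= / 2).
    { replace (/ 2) with (M * / (2 * M)) by (field; lra).
      apply Rmult_le_compat_l; lra. }
    lra.
Qed.

(** Otherwise nested balls would yield a point l and times t_k tending to 0 at
    which T t_k l is unbounded, whereas T t l tends to l. *)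
Lemma semigroup_bounded_near_zero :
  exists d M, 0 < d /\ 1 <= M /\
    forall t x, 0 <= t <= d -> norm (T t x) <= M * norm x.
Proof.
  apply NNPP. intros hno.
  assert (h : forall d, 0 < d -> forall K, 1 <= K ->
    exists t v, 0 <= t <= d /\ K * norm v < norm (T t v)).
  { intros d hd K hK. apply NNPP. intros hno'. apply hno.
    exists d, K. repeat split; auto. intros t x ht.
    apply Rnot_lt_le. intros hlt. apply hno'. eauto. }
  assert (hpos : forall k, 0 < / (INR k + 1)).
  { intros k. apply Rinv_0_lt_compat. pose proof (pos_INR k). lra. }
  (* A pair (x, r) stands for the closed ball of radius r around x. *)
  set (next := fun (k : nat) (p q : X * R) => 0 < snd p ->
    0 < snd q /\ snd q <= snd p / 2 /\
    ndist (fst q) (fst p) <= snd p / 2 /\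
    exists t, 0 <= t <= / (INR k + 1) /\
      forall z, ndist z (fst q) <= snd q -> INR k < norm (T t z)).
  assert (step : forall k p, {q | next k p q}).
  { intros k [x r]. apply constructive_indefinite_description.
    unfold next. simpl. destruct (Rlt_dec 0 r) as [hr|hr].
    - destruct (unbounded_escape x (pos_INR k) hr (h _ (hpos k)))
        as (y & r' & t & h1 & h2 & h3 & h4 & h5).
      exists (y, r'). simpl. intros _. repeat split; auto. exists t. auto.
    - exists (x, r). intros; contradiction. }
  set (s := nat_rect (fun _ => (X * R)%type) (zero, 1)
              (fun k p => proj1_sig (step k p))).
  assert (hs : forall k, next k (s k) (s (S k))).
  { intros k. exact (proj2_sig (step k (s k))). }
  assert (hr : forall k, 0 < snd (s k)).
  { induction k as [|k IH]; [simpl; lra|]. apply (hs k IH). }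
  assert (hgeo : forall k, snd (s k) <= / (INR k + 1)).
  { induction k as [|k IH].
    - simpl. right. field.
    - destruct (hs k (hr k)) as (_ & h2 & _).
      eapply Rle_trans; [exact h2|].
      rewrite S_INR. pose proof (pos_INR k).
      apply Rle_trans with (/ (INR k + 1) / 2); [lra|].
      unfold Rdiv. rewrite <- Rinv_mult.
      apply Rinv_le_contravar; lra. }
  assert (hnest : forall k j z, (k <= j)%nat ->
    ndist z (fst (s j)) <= snd (s j) ->
    ndist z (fst (s k)) <= snd (s k)).
  { intros k j z hkj. induction hkj as [|j hkj IH]; [tauto|].
    intros hz. apply IH. destruct (hs j (hr j)) as (_ & h2 & h3 & _).
    pose proof (ndist_triangle z (fst (s (S j))) (fst (s j))). lra. }
  destruct (@complete_norm_limit X (fun k => fst (s k)) (fun k => snd (s k)))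
    as [l hl].
  { intros k j hkj. apply (hnest k j); [exact hkj|].
    rewrite ndist_refl. left. apply hr. }
  { intros e he. destruct (nfloor_ex (/ e)) as [n hn].
    { left. apply Rinv_0_lt_compat, he. }
    exists n. eapply Rle_lt_trans; [apply hgeo|].
    rewrite <- (Rinv_inv e). apply Rinv_lt_contravar; [|lra].
    apply Rmult_lt_0_compat; [apply Rinv_0_lt_compat, he|].
    pose proof (pos_INR n). lra. }
  assert (hlim : filterlim (fun t => T t l) (at_right 0) (locally l)) by apply hT.
  assert (hloc : locally l (fun y => ndist y l < 1)).
  { apply locally_ndist. lra. }
  destruct (hlim _ hloc) as [d hd].
  destruct (nfloor_ex (Rmax (/ d) (norm l + 1))) as [n [_ hn]].
  { eapply Rle_trans; [|apply Rmax_r]. pose proof (norm_ge_0 l). lra. }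
  assert (hn1 : / d < INR (S n)).
  { rewrite S_INR. eapply Rle_lt_trans; [apply Rmax_l|exact hn]. }
  assert (hn2 : norm l + 1 < INR (S n)).
  { rewrite S_INR. eapply Rle_lt_trans; [apply Rmax_r|exact hn]. }
  destruct (hs (S n) (hr (S n))) as (_ & _ & _ & t & ht & hbig).
  specialize (hbig l (hl (S (S n)))).
  destruct (Rle_lt_or_eq_dec 0 t (proj1 ht)) as [ht0|ht0].
  - assert (htd : t < d).
    { eapply Rle_lt_trans; [apply ht|].
      pose proof (cond_pos d).
      rewrite <- (Rinv_inv d). apply Rinv_lt_contravar; [|lra].
      apply Rmult_lt_0_compat; [apply Rinv_0_lt_compat; auto|].
      pose proof (pos_INR (S n)). lra. }
    assert (hball : ball 0 d t).
    { change (Rabs (t - 0) < d). rewrite Rabs_pos_eq; lra. }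
    specialize (hd t hball ht0). simpl in hd.
    pose proof (norm_le_ndist (T t l) l). lra.
  - subst t. replace (T 0 l) with l in hbig by (symmetry; apply hT). lra.
Qed.

Lemma semigroup_bounded (tau : R) :
  exists M, 0 < M /\ forall t x, 0 <= t <= tau -> norm (T t x) <= M * norm x.
Proof.
  destruct semigroup_bounded_near_zero as (d & M & hd & hM & hb).
  assert (hn : forall n t x, 0 <= t <= INR n * d ->
    norm (T t x) <= M ^ n * norm x).
  { induction n as [|n IH]; intros t x ht.
    - simpl in *. replace t with 0 by lra.
      replace (T 0 x) with x by (symmetry; apply hT). lra.
    - rewrite S_INR in ht. simpl.
      assert (hMn : 1 <= M ^ n) by (apply pow_R1_Rle; exact hM).
      pose proof (norm_ge_0 x).
      destruct (Rle_dec t d) as [htd|htd].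
      + eapply Rle_trans; [apply hb; lra|].
        apply Rmult_le_compat_r; [lra|]. nra.
      + replace t with (d + (t - d)) by ring.
        destruct hT as (_ & _ & hadd & _). rewrite hadd by lra.
        eapply Rle_trans; [apply hb; lra|]. rewrite Rmult_assoc.
        apply Rmult_le_compat_l; [lra|]. apply IH. lra. }
  destruct (nfloor_ex (Rmax 0 (tau / d)) (Rmax_l _ _)) as [n [_ hn']].
  exists (M ^ S n). split; [apply pow_lt; lra|].
  intros t x ht. apply hn. split; [lra|]. rewrite S_INR.
  assert (tau / d <= INR n + 1).
  { pose proof (Rmax_r 0 (tau / d)). lra. }
  replace tau with (tau / d * d) in ht by (field; lra).
  assert (tau / d * d <= (INR n + 1) * d) by (apply Rmult_le_compat_r; lra).
  lra.
Qed.

End Semigroup.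

Lemma Riemann_sum_linear (V W : NormedModule R_AbsRing) (l : V -> W)
    (g : R -> V) (ptd : SF_seq) : is_linear l ->
  Riemann_sum (fun s => l (g s)) ptd = l (Riemann_sum g ptd).
Proof.
  intros hl. induction ptd using SF_cons_ind.
  - unfold Riemann_sum. simpl. symmetry. exact (linear_zero l hl).
  - rewrite !Riemann_sum_cons, IHptd. symmetry.
    etransitivity; [exact (linear_plus l hl _ _)|].
    apply (f_equal (fun v => plus v (l (Riemann_sum g ptd)))).
    exact (linear_scal l hl _ _).
Qed.

Lemma is_RInt_linear (V W : NormedModule R_AbsRing) (l : V -> W)
    (g : R -> V) (a b : R) (v : V) : is_linear l ->
  is_RInt g a b v -> is_RInt (fun s => l (g s)) a b (l v).
Proof.
  intros hl hg.
  apply filterlim_ext with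
    (fun ptd => l (scal (sign (b - a)) (Riemann_sum g ptd))).
  - intros ptd. rewrite (Riemann_sum_linear g ptd hl).
    exact (linear_scal l hl _ _).
  - eapply filterlim_comp; [exact hg|]. apply linear_cont, hl.
Qed.

(** * Mild solutions *)

(** With W the integral of z, the function (a + b W t) e^(-b t) has nonpositive
    derivative, hence stays below its value a at 0. *)
Lemma gronwall (z : R -> R) (a b tau : R) : 0 <= b ->
  (forall t, continuous z t) ->
  (forall t, 0 <= t <= tau -> z t <= a + b * RInt z 0 t) ->
  forall t, 0 <= t <= tau -> z t <= a * exp (b * t).
Proof.
  intros hb hz hint t ht.
  assert (hex : forall s, ex_RInt z 0 s) by (intros s; apply (ex_RInt_continuous (V := R_CompleteNormedModule)); auto).
  set (W := fun s => RInt z 0 s).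
  assert (hW : forall s, is_derive W s (z s)).
  { intros s. apply is_derive_RInt with 0; [|apply hz].
    apply filter_forall. intros r. apply (RInt_correct (V := R_CompleteNormedModule)), hex. }
  set (G := fun s => (a + b * W s) * exp (- (b * s))).
  set (G' := fun s => (b * z s - b * (a + b * W s)) * exp (- (b * s))).
  assert (hG : forall s, is_derive G s (G' s)).
  { intros s. unfold G, G'. auto_derive.
    - exists (z s). apply hW.
    - replace (Derive (fun r => W r) s) with (z s)
        by (symmetry; apply is_derive_unique, hW).
      ring. }
  destruct (MVT_gen G 0 t G') as (c & hc & heq).
  { intros s _. apply hG. }
  { intros s _. apply continuity_pt_filterlim.
    apply (ex_derive_continuous G s). exists (G' s). apply hG. }
  rewrite Rmin_left, Rmax_right in hc by lra.
  assert (hW0 : W 0 = 0) by (unfold W; rewrite RInt_point; reflexivity).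
  assert (hG0 : G 0 = a).
  { unfold G. rewrite hW0, !Rmult_0_r, Ropp_0, exp_0. ring. }
  assert (hG'c : G' c <= 0).
  { unfold G'. pose proof (exp_pos (- (b * c))).
    assert (hzc : z c <= a + b * W c) by (apply hint; lra).
    assert (b * z c <= b * (a + b * W c)) by (apply Rmult_le_compat_l; lra).
    nra. }
  assert (hGt : G t <= a) by nra.
  unfold G in hGt. rewrite exp_Ropp in hGt.
  pose proof (exp_pos (b * t)) as hpos.
  apply Rle_trans with (a + b * W t); [apply hint; exact ht|].
  apply Rmult_le_reg_r with (/ exp (b * t)); [apply Rinv_0_lt_compat; lra|].
  rewrite Rmult_assoc, Rinv_r by lra. lra.
Qed.

(** Freezing a trajectory at negative times turns continuity on the half-line into
    continuity on the whole line, the form in which integrals need it. *)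
Lemma continuous_extension (V : UniformSpace) (y : R -> V) (t : R) :
  continuous_on Rplus_set y -> continuous (fun s => y (Rmax 0 s)) t.
Proof.
  intros hy P hP.
  destruct (hy (Rmax 0 t) (Rmax_l 0 t) P hP) as [d hd].
  exists d. intros s hs. apply hd; [|apply Rmax_l].
  change (Rabs (Rmax 0 s - Rmax 0 t) < d). change (Rabs (s - t) < d) in hs.
  eapply Rle_lt_trans; [|exact hs].
  unfold Rmax, Rabs. repeat destruct (Rle_dec _ _);
    repeat destruct (Rcase_abs _); lra.
Qed.

Lemma continuous_ndist (V : NormedModule R_AbsRing) (y1 y2 : R -> V) (t : R) :
  continuous y1 t -> continuous y2 t ->
  continuous (fun s => ndist (y1 s) (y2 s)) t.
Proof.
  intros h1 h2. unfold ndist.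
  apply (continuous_comp (fun s => minus (y1 s) (y2 s)) norm).
  - apply (continuous_minus y1 y2 t h1 h2).
  - apply filterlim_norm.
Qed.

Lemma trajectory_bounded (V : NormedModule R_AbsRing) (y : R -> V) (tau : R) :
  continuous_on Rplus_set y ->
  exists C, 0 < C /\ forall t, 0 <= t <= tau -> norm (y t) < C.
Proof.
  intros hy.
  destruct (bounded_continuity (fun s => y (Rmax 0 s)) 0 tau) as [C hC].
  { intros s _. apply continuous_extension, hy. }
  exists (Rmax C 1). split; [pose proof (Rmax_r C 1); lra|].
  intros t ht. eapply Rlt_le_trans; [|apply Rmax_l].
  specialize (hC t ht). simpl in hC. rewrite Rmax_right in hC by lra. exact hC.
Qed.

Section Mild.

Variable X : CompleteNormedModule R_AbsRing.
Variable U : NormedModule R_AbsRing.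
Variable T : R -> X -> X.
Variable f : X -> U -> X.
Hypothesis hT : C0_semigroup T.

(** The variation-of-constants formulas for y1 and y2 subtract to an integral
    inequality for their distance, to which Gronwall's inequality applies.  The
    constant c absorbs the discrepancy of the inputs. *)
Lemma mild_difference (x1 x2 : X) (u1 u2 : R -> U) (y1 y2 : R -> X)
    (tau M L c : R) :
  is_mild_solution T f x1 u1 y1 -> is_mild_solution T f x2 u2 y2 ->
  0 <= M -> 0 <= L -> 0 <= c ->
  (forall t x, 0 <= t <= tau -> norm (T t x) <= M * norm x) ->
  (forall s, 0 <= s <= tau ->
    ndist (f (y1 s) (u1 s)) (f (y2 s) (u2 s)) <= L * ndist (y1 s) (y2 s) + c) ->
  forall t, 0 <= t <= tau ->
    ndist (y1 t) (y2 t) <= (M * ndist x1 x2 + M * c * tau) * exp (M * L * t).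
Proof.
  intros (hc1 & h01 & hm1) (hc2 & h02 & hm2) hM hL hc hTM hf.
  set (z := fun t => ndist (y1 (Rmax 0 t)) (y2 (Rmax 0 t))).
  assert (hz : forall t, continuous z t).
  { intros t. apply continuous_ndist; apply continuous_extension; assumption. }
  assert (hzeq : forall t, 0 <= t -> z t = ndist (y1 t) (y2 t)).
  { intros t ht. unfold z. rewrite Rmax_right by lra. reflexivity. }
  intros t ht. rewrite <- hzeq by lra.
  revert t ht. apply gronwall; [apply Rmult_le_pos; lra|exact hz|].
  intros t ht. rewrite hzeq by lra.
  assert (hlin : forall s, 0 <= s <= tau -> forall v w,
    ndist (T s v) (T s w) <= M * ndist v w).
  { intros s hs. apply is_linear_ndist; [apply hT; lra|].
    intros v. apply hTM. exact hs. }
  destruct (hm1 t (proj1 ht)) as [he1 hy1].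
  destruct (hm2 t (proj1 ht)) as [he2 hy2].
  set (g1 := fun s => T (t - s) (f (y1 s) (u1 s))) in *.
  set (g2 := fun s => T (t - s) (f (y2 s) (u2 s))) in *.
  assert (hI : ndist (RInt g1 0 t) (RInt g2 0 t) <=
                 scal (M * L) (RInt z 0 t) + scal (t - 0) (M * c)).
  { assert (hi1 : is_RInt (fun s => minus (g1 s) (g2 s)) 0 t
                    (minus (RInt g1 0 t) (RInt g2 0 t))).
    { apply (is_RInt_minus g1 g2); apply RInt_correct; assumption. }
    assert (hi2 : is_RInt (fun s => plus (scal (M * L) (z s)) (M * c)) 0 t
                    (plus (scal (M * L) (RInt z 0 t)) (scal (t - 0) (M * c)))).
    { apply (is_RInt_plus (fun s => scal (M * L) (z s)) (fun _ => M * c)).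
      - apply (is_RInt_scal z 0 t (M * L)), (RInt_correct (V := R_CompleteNormedModule)).
        apply (ex_RInt_continuous (V := R_CompleteNormedModule)). auto.
      - apply (is_RInt_const 0 t (M * c)). }
    refine (norm_RInt_le _ _ 0 t _ _ (proj1 ht) _ hi1 hi2).
    intros s hs. change (ndist (g1 s) (g2 s) <= M * L * z s + M * c).
    rewrite hzeq by lra. unfold g1, g2.
    eapply Rle_trans; [apply hlin; lra|].
    replace (M * L * ndist (y1 s) (y2 s) + M * c)
      with (M * (L * ndist (y1 s) (y2 s) + c)) by ring.
    apply Rmult_le_compat_l; [exact hM|]. apply hf. lra. }
  assert (hS : ndist (T t (y1 0)) (T t (y2 0)) <= M * ndist x1 x2).
  { rewrite h01, h02. apply hlin. exact ht. }
  assert (hsum : ndist (y1 t) (y2 t) <=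
     ndist (T t (y1 0)) (T t (y2 0)) + ndist (RInt g1 0 t) (RInt g2 0 t)).
  { rewrite hy1, hy2. apply ndist_plus_plus. }
  change (scal (M * L) (RInt z 0 t)) with (M * L * RInt z 0 t) in hI.
  change (scal (t - 0) (M * c)) with ((t - 0) * (M * c)) in hI.
  assert ((t - 0) * (M * c) <= M * c * tau).
  { rewrite Rmult_comm. apply Rmult_le_compat_l; [|lra].
    apply Rmult_le_pos; lra. }
  lra.
Qed.

Lemma mild_unique (x : X) (u : R -> U) (y1 y2 : R -> X) (t : R) :
  lipschitz_on_balls f ->
  is_mild_solution T f x u y1 -> is_mild_solution T f x u y2 ->
  0 <= t -> y1 t = y2 t.
Proof.
  intros hf h1 h2 ht.
  destruct (trajectory_bounded t (proj1 h1)) as (C1 & hC1 & hb1).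
  destruct (trajectory_bounded t (proj1 h2)) as (C2 & hC2 & hb2).
  destruct (hf (C1 + C2)) as (L & hL & hlip); [lra|].
  destruct (semigroup_bounded hT t) as (M & hM & hTM).
  apply ndist_eq_0.
  assert (h : ndist (y1 t) (y2 t) <=
    (M * ndist x x + M * 0 * t) * exp (M * L * t)).
  { apply (@mild_difference x x u u y1 y2 t M L 0); auto; try lra.
    intros s hs. rewrite Rplus_0_r. specialize (hb1 s hs). specialize (hb2 s hs).
    apply hlip; lra. }
  rewrite ndist_refl in h.
  replace ((M * 0 + M * 0 * t) * exp (M * L * t)) with 0 in h by ring. exact h.
Qed.

(** The integral up to t + s splits at s; by the semigroup law T t factors out of
    the part before s, and the bounded operator T t commutes with the integral. *)
Lemma mild_shift (x : X) (u : R -> U) (y : R -> X) (s : R) : 0 <= s ->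
  is_mild_solution T f x u y ->
  is_mild_solution T f (y s) (fun t => u (t + s)) (fun t => y (t + s)).
Proof.
  intros hs (hc & _ & hm). split; [|split].
  - intros t ht P hP.
    assert (hts : Rplus_set (t + s)) by (unfold Rplus_set in *; lra).
    destruct (hc (t + s) hts P hP) as [d hd].
    exists d. intros r hr hr0. apply hd; [|unfold Rplus_set in *; lra].
    change (Rabs (r + s - (t + s)) < d). change (Rabs (r - t) < d) in hr.
    replace (r + s - (t + s)) with (r - t) by ring. exact hr.
  - rewrite Rplus_0_l. reflexivity.
  - intros t ht.
    assert (hts : 0 <= t + s) by lra.
    destruct (hm (t + s) hts) as [hex heq]. destruct (hm s hs) as [hexs heqs].
    set (G := fun r => T (t + s - r) (f (y r) (u r))) in *.
    set (H := fun r => T (s - r) (f (y r) (u r))) in *.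
    assert (hex1 : ex_RInt G 0 s) by (apply ex_RInt_Chasles_1 with (t + s); auto; lra).
    assert (hex2 : ex_RInt G s (t + s))
      by (apply ex_RInt_Chasles_2 with 0; auto; lra).
    assert (hint : is_RInt (fun r => T (t - r) (f (y (r + s)) (u (r + s)))) 0 t
                     (RInt G s (t + s))).
    { apply is_RInt_ext with (fun r => scal 1 (G (1 * r + s))).
      - intros r _. etransitivity; [apply (scal_one (K := R_AbsRing))|].
        unfold G. rewrite Rmult_1_l. f_equal. ring.
      - refine (is_RInt_comp_lin G 1 s 0 t _ _).
        replace (1 * 0 + s) with s by ring. replace (1 * t + s) with (t + s) by ring.
        apply RInt_correct, hex2. }
    assert (hlin : is_linear (T t)) by (apply hT; exact ht).
    assert (hG : RInt G 0 s = T t (RInt H 0 s)).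
    { apply is_RInt_unique.
      apply is_RInt_ext with (fun r => T t (H r)).
      - intros r hr. rewrite Rmin_left, Rmax_right in hr by lra.
        unfold G, H. replace (t + s - r) with (t + (s - r)) by ring.
        symmetry. apply hT; lra.
      - apply is_RInt_linear; [exact hlin|]. apply RInt_correct, hexs. }
    split; [eexists; exact hint|].
    rewrite (is_RInt_unique _ _ _ _ hint), Rplus_0_l, heq, heqs.
    rewrite <- (RInt_Chasles G 0 s (t + s) hex1 hex2), hG.
    destruct hT as (_ & _ & hadd & _). rewrite (hadd t s) by assumption.
    etransitivity; [apply plus_assoc|].
    apply (f_equal (fun v => plus v (RInt G s (t + s)))).
    symmetry. exact (linear_plus _ hlin _ _).
Qed.

Lemma mild_zero : f zero zero = zero ->
  is_mild_solution T f zero (fun _ => zero) (fun _ => zero).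
Proof.
  intros hf.
  assert (hTz : forall s, 0 <= s -> T s zero = zero).
  { intros s hs. refine (linear_zero (T s) _). apply hT, hs. }
  split; [|split; [reflexivity|]].
  - intros t _. apply filterlim_const.
  - intros t ht.
    assert (hint : is_RInt (fun s => T (t - s) (f zero zero)) 0 t zero).
    { apply is_RInt_ext with (fun _ => zero).
      - intros s hs. rewrite Rmin_left, Rmax_right in hs by lra.
        rewrite hf. symmetry. apply hTz. lra.
      - exact (eq_ind _ (is_RInt (fun _ => zero) 0 t)
                 (is_RInt_const 0 t (zero : X)) _ (scal_zero_r _)). }
    split; [eexists; exact hint|].
    rewrite (is_RInt_unique _ _ _ _ hint), hTz by exact ht.
    symmetry. apply plus_zero_r.
Qed.

End Mild.

(** * Inputs and the flow *)

Section Inputs.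

Variable U : NormedModule R_AbsRing.

Lemma PC_zero : PC (fun _ : R => zero : U).
Proof.
  split; [|split; [|split]].
  - intros t _. apply filterlim_const.
  - intros t _. exists zero. apply filterlim_const.
  - intros b. exists nil. intros t _ _ _. apply filterlim_const.
  - exists 0. intros t _. rewrite norm_zero. lra.
Qed.

Lemma norm_le_norm_PC (u : R -> U) (t : R) : PC u -> 0 <= t ->
  norm (u t) <= norm_PC u.
Proof.
  intros (_ & _ & _ & M & hM) ht.
  apply (@sup_of_ub (fun r => exists t, 0 <= t /\ r = norm (u t)) M).
  - intros r (s & hs & ->). apply hM, hs.
  - exists t. auto.
Qed.

Lemma norm_PC_le (u : R -> U) (M : R) :
  (forall t, 0 <= t -> norm (u t) <= M) -> norm_PC u <= M.
Proof.
  intros hM.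
  apply (@sup_of_lub (fun r => exists t, 0 <= t /\ r = norm (u t)) M (norm (u 0))).
  - exists 0. split; [lra|reflexivity].
  - intros r (s & hs & ->). apply hM, hs.
Qed.

Lemma norm_PC_nonneg (u : R -> U) : PC u -> 0 <= norm_PC u.
Proof.
  intros hu. eapply Rle_trans; [apply (norm_ge_0 (u 0))|].
  apply norm_le_norm_PC; [exact hu|lra].
Qed.

Lemma norm_PC_zero : norm_PC (fun _ : R => zero : U) = 0.
Proof.
  apply Rle_antisym; [|apply norm_PC_nonneg, PC_zero].
  apply norm_PC_le. intros t _. rewrite norm_zero. lra.
Qed.

Lemma locally_translate (t s : R) (P : R -> Prop) :
  locally (t + s) P -> locally t (fun r => P (r + s)).
Proof.
  intros [d hd]. exists d. intros r hr. apply hd.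
  change (Rabs (r + s - (t + s)) < d). change (Rabs (r - t) < d) in hr.
  replace (r + s - (t + s)) with (r - t) by ring. exact hr.
Qed.

Lemma PC_shift (u : R -> U) (s : R) : 0 <= s -> PC u ->
  PC (fun t => u (t + s)).
Proof.
  intros hs (hr & hl & hd & M & hM). split; [|split; [|split]].
  - intros t ht P hP.
    assert (hts : 0 <= t + s) by lra. specialize (hr (t + s) hts P hP).
    refine (filter_imp _ _ _
      (@locally_translate t s (fun r => t + s < r -> P (u r)) hr)).
    intros r h hlt. apply h. lra.
  - intros t ht. assert (hts : 0 < t + s) by lra.
    destruct (hl (t + s) hts) as [l h]. exists l. intros P hP.
    refine (filter_imp _ _ _
      (@locally_translate t s (fun r => r < t + s -> P (u r)) (h P hP))).
    intros r h' hlt. apply h'. lra.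
  - intros b. destruct (hd (b + s)) as [D hD].
    exists (map (fun d => d - s) D). intros t ht hb hin P hP.
    apply (@locally_translate t s (fun r => P (u r))).
    apply hD; try lra; [|exact hP]. intros h. apply hin.
    apply in_map_iff. exists (t + s). split; [ring|exact h].
  - exists M. intros t ht. apply hM. lra.
Qed.

Lemma norm_PC_shift (u : R -> U) (s : R) : 0 <= s -> PC u ->
  norm_PC (fun t => u (t + s)) <= norm_PC u.
Proof.
  intros hs hu. apply norm_PC_le. intros t ht.
  apply norm_le_norm_PC; [exact hu|lra].
Qed.

End Inputs.

Section Flow.

Variable X : CompleteNormedModule R_AbsRing.
Variable U : NormedModule R_AbsRing.
Variable T : R -> X -> X.
Variable f : X -> U -> X.
Hypothesis hT : C0_semigroup T.
Hypothesis hf1 : lipschitz_on_balls f.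
Hypothesis hfc : forward_complete T f.

Lemma flow_mild (x : X) (u : R -> U) : PC u ->
  is_mild_solution T f x u (fun t => flow T f t x u).
Proof.
  intros hu.
  exact (epsilon_spec (inhabits (fun _ : R => zero : X))
           (is_mild_solution T f x u) (hfc x hu)).
Qed.

Lemma flow_unique (x : X) (u : R -> U) (y : R -> X) (t : R) : PC u ->
  is_mild_solution T f x u y -> 0 <= t -> flow T f t x u = y t.
Proof.
  intros hu hy ht.
  exact (mild_unique hT hf1 (flow_mild x hu) hy ht).
Qed.

Lemma flow_cocycle (x : X) (u : R -> U) (s t : R) : PC u -> 0 <= s -> 0 <= t ->
  flow T f (t + s) x u = flow T f t (flow T f s x u) (fun r => u (r + s)).
Proof.
  intros hu hs ht. symmetry.
  apply (@flow_unique (flow T f s x u) (fun r => u (r + s))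
           (fun r => flow T f (r + s) x u)); [apply PC_shift; auto| |exact ht].
  exact (mild_shift hT hs (flow_mild x hu)).
Qed.

(** Continuity at the equilibrium: compare the trajectory with the zero solution. *)
Lemma flow_small_data (eps h : R) : f zero zero = zero -> BRS (flow T f) ->
  0 < eps -> 0 < h ->
  exists delta, 0 < delta /\ forall x t, norm x <= delta -> 0 <= t <= h ->
    norm (flow T f t x (fun _ => zero)) <= eps.
Proof.
  intros hf0 hB he hh.
  destruct (hB 1 h Rlt_0_1 hh) as [K hK].
  assert (hC : 0 < Rmax 0 K + 1) by (pose proof (Rmax_l 0 K); lra).
  destruct (hf1 hC) as (L & hL & hlip).
  destruct (semigroup_bounded hT h) as (M & hM & hTM).
  pose proof (exp_pos (M * L * h)) as hexp.
  exists (Rmin 1 (eps / (M * exp (M * L * h)))).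
  assert (hME : 0 < M * exp (M * L * h)) by (apply Rmult_lt_0_compat; lra).
  split.
  { apply Rmin_pos; [lra|]. apply Rdiv_lt_0_compat; lra. }
  intros x t hx ht.
  assert (hx1 : norm x <= 1) by (eapply Rle_trans; [exact hx|apply Rmin_l]).
  assert (hx2 : norm x <= eps / (M * exp (M * L * h)))
    by (eapply Rle_trans; [exact hx|apply Rmin_r]).
  assert (hd : ndist (flow T f t x (fun _ => zero)) zero <=
     (M * ndist x zero + M * 0 * h) * exp (M * L * t)).
  { apply (@mild_difference X U T f hT x zero (fun _ => zero) (fun _ => zero)
            (fun t => flow T f t x (fun _ => zero)) (fun _ => zero) h M L 0);
      auto; try lra.
    - apply flow_mild, PC_zero.
    - apply mild_zero; assumption.
    - intros s hs. rewrite Rplus_0_r. apply hlip.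
      + eapply Rle_lt_trans.
        * apply hK; [apply PC_zero|exact hx1| |exact hs].
          rewrite norm_PC_zero. lra.
        * pose proof (Rmax_r 0 K). lra.
      + exact (eq_ind_r (fun r => r < _) hC (@norm_zero R_AbsRing X)). }
  rewrite !ndist_zero_r in hd. eapply Rle_trans; [exact hd|].
  assert (hmono : exp (M * L * t) <= exp (M * L * h)).
  { apply exp_monotone. apply Rmult_le_compat_l; [|lra].
    apply Rmult_le_pos; lra. }
  pose proof (norm_ge_0 x).
  apply Rle_trans with (norm x * (M * exp (M * L * h))).
  - replace ((M * norm x + M * 0 * h) * exp (M * L * t))
      with (norm x * (M * exp (M * L * t))) by ring.
    apply Rmult_le_compat_l; [lra|]. apply Rmult_le_compat_l; lra.
  - apply Rle_trans with
      (eps / (M * exp (M * L * h)) * (M * exp (M * L * h))).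
    + apply Rmult_le_compat_r; lra.
    + right. field. split; lra.
Qed.

End Flow.

(** Continuity of the flow in the input at u = 0, along undisturbed trajectories
    that stay in a fixed ball. *)
Definition input_continuity_at_zero (X U : NormedModule R_AbsRing)
    (phi : R -> X -> (R -> U) -> X) : Prop :=
  exists rho, 0 < rho /\ forall eps h, 0 < eps -> 0 < h ->
    exists delta, 0 < delta /\ forall x u, PC u -> norm x <= 1 ->
      norm_PC u <= delta ->
      (forall t, 0 <= t <= h -> norm (phi t x (fun _ => zero)) <= rho) ->
      forall t, 0 <= t <= h ->
        ndist (phi t x u) (phi t x (fun _ => zero)) <= eps.

(** Split f(x,u) - f(y,0) into f(x,u) - f(y,u), controlled by the Lipschitz
    condition, and f(y,u) - f(y,0), controlled by the class K bound on the ball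
    of radius rho, where the undisturbed trajectory y stays. *)
Lemma flow_input_continuity (X : CompleteNormedModule R_AbsRing)
    (U : NormedModule R_AbsRing) (T : R -> X -> X) (f : X -> U -> X) :
  C0_semigroup T -> lipschitz_on_balls f -> forward_complete T f ->
  input_K_bound f -> BRS (flow T f) ->
  input_continuity_at_zero (flow T f).
Proof.
  intros hT hf1 hfc (sigma & rho & hsigma & hrho & hf3) hB.
  exists rho. split; [exact hrho|]. intros eps h he hh.
  destruct (hB 1 h Rlt_0_1 hh) as [K hK].
  set (C := Rmax 0 K + rho + 1).
  assert (hC : K < C /\ rho < C /\ 0 < C).
  { unfold C. pose proof (Rmax_l 0 K). pose proof (Rmax_r 0 K). lra. }
  destruct (hf1 C (proj2 (proj2 hC))) as (L & hL & hlip).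
  destruct (semigroup_bounded hT h) as (M & hM & hTM).
  pose proof (exp_pos (M * L * h)) as hexp.
  assert (hME : 0 < M * h * exp (M * L * h))
    by (repeat apply Rmult_lt_0_compat; lra).
  set (c := eps / (M * h * exp (M * L * h))).
  assert (hc : 0 < c) by (apply Rdiv_lt_0_compat; lra).
  destruct (class_K_small hsigma hc) as (d & hd & hsd).
  exists (Rmin (Rmin 1 d) (rho / 2)). split.
  { repeat apply Rmin_pos; lra. }
  intros x u hu hx hun hzero t ht.
  assert (hu1 : norm_PC u <= 1 /\ norm_PC u <= d /\ norm_PC u < rho).
  { revert hun. unfold Rmin. repeat destruct (Rle_dec _ _); lra. }
  assert (hdiff : ndist (flow T f t x u) (flow T f t x (fun _ => zero)) <=
     (M * ndist x x + M * c * h) * exp (M * L * t)).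
  { apply (@mild_difference X U T f hT x x u (fun _ => zero)
            (fun t => flow T f t x u) (fun t => flow T f t x (fun _ => zero))
            h M L c); auto; try lra.
    - apply flow_mild; assumption.
    - apply flow_mild; [assumption|apply PC_zero].
    - intros s hs.
      assert (hus : norm (u s) <= norm_PC u) by (apply norm_le_norm_PC; tauto).
      specialize (hzero s hs).
      eapply Rle_trans;
        [apply (ndist_triangle _ (f (flow T f s x (fun _ => zero)) (u s)))|].
      apply Rplus_le_compat.
      + apply hlip; [|lra].
        eapply Rle_lt_trans; [apply hK|]; auto; lra.
      + eapply Rle_trans; [apply hf3; lra|].
        eapply Rle_trans; [|exact hsd].
        apply class_K_le; [exact hsigma|apply norm_ge_0|lra]. }
  rewrite ndist_refl in hdiff. eapply Rle_trans; [exact hdiff|].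
  assert (hmono : exp (M * L * t) <= exp (M * L * h)).
  { apply exp_monotone. apply Rmult_le_compat_l; [|lra].
    apply Rmult_le_pos; lra. }
  replace ((M * 0 + M * c * h) * exp (M * L * t))
    with (M * c * h * exp (M * L * t)) by ring.
  apply Rle_trans with (M * c * h * exp (M * L * h)).
  - apply Rmult_le_compat_l; [|exact hmono].
    apply Rmult_le_pos; [apply Rmult_le_pos|]; lra.
  - right. unfold c. field. repeat split; lra.
Qed.

(** * From limit behaviour to input-to-state stability *)

Lemma class_K0_majorant (g : R -> R) : class_K0 g ->
  exists g', class_K g' /\ forall r, 0 <= r -> g r <= g' r.
Proof.
  intros [hg|hg].
  - exists g. split; [exact hg|]. intros; lra.
  - exists (fun r => r). split; [apply class_K_id|].
    intros r hr. rewrite hg; assumption.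
Qed.

Lemma class_Kinf0_K0 (g : R -> R) : class_Kinf0 g -> class_K0 g.
Proof. intros [[hg _]|hg]; [left|right]; exact hg. Qed.

Lemma class_K0_at_0 (g : R -> R) : class_K0 g -> g 0 = 0.
Proof. intros [(_ & _ & h)|h]; [exact h|]. apply h. lra. Qed.

Section Stability.

Variable X : CompleteNormedModule R_AbsRing.
Variable U : NormedModule R_AbsRing.
Variable phi : R -> X -> (R -> U) -> X.
Hypothesis phi_cocycle : forall x u s t, PC u -> 0 <= s -> 0 <= t ->
  phi (t + s) x u = phi t (phi s x u) (fun r => u (r + s)).

Definition zero_stable : Prop :=
  forall eps, 0 < eps -> exists delta, 0 < delta /\
    forall x t, norm x <= delta -> 0 <= t ->
      norm (phi t x (fun _ => zero)) <= eps.

(** Each return takes at least one unit of time, so induction on the integer part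
    of t covers all times.  Without the lower bound 1 a return could be
    immediate and the induction would not progress. *)
Lemma bound_from_returns (a b K h : R) :
  (forall x u, PC u -> norm x <= a -> norm_PC u <= b ->
    (forall t, 0 <= t <= h -> norm (phi t x u) <= K) /\
    exists s, 1 <= s <= h /\ norm (phi s x u) <= a) ->
  forall x u t, PC u -> norm x <= a -> norm_PC u <= b -> 0 <= t ->
    norm (phi t x u) <= K.
Proof.
  intros hret.
  assert (main : forall n x u t, PC u -> norm x <= a -> norm_PC u <= b ->
    0 <= t <= INR n -> norm (phi t x u) <= K).
  { induction n as [|n IH]; intros x u t hu hx hub ht;
      destruct (hret x u hu hx hub) as (hK & s & hs & hsa).
    - simpl in ht. apply hK. lra.
    - rewrite S_INR in ht. destruct (Rle_dec t h) as [hth|hth].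
      + apply hK. lra.
      + replace t with (t - s + s) by ring.
        rewrite phi_cocycle by (auto; lra).
        apply IH; [apply PC_shift; auto; lra|exact hsa| |lra].
        eapply Rle_trans; [apply norm_PC_shift; auto; lra|exact hub]. }
  intros x u t hu hx hub ht.
  destruct (nfloor_ex t ht) as [n hn].
  apply (main (S n)); auto. rewrite S_INR. lra.
Qed.

(** The time provided by ULIM may be 0; starting ULIM from the state at time 1
    forces the return to happen no earlier than time 1. *)
Lemma ULIM_return_after_1 (gamma : R -> R) (eps K a tau : R) :
  (forall x u, PC u -> norm x <= K -> exists t, 0 <= t <= tau /\
     norm (phi t x u) <= eps + gamma (norm_PC u)) ->
  class_K gamma -> forall x u b, PC u -> norm_PC u <= b ->
  norm (phi 1 x u) <= K -> eps + gamma b <= a ->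
  exists s, 1 <= s <= 1 + Rmax 0 tau /\ norm (phi s x u) <= a.
Proof.
  intros hlim hg x u b hu hub hK ha.
  assert (h1 : 0 <= 1) by lra.
  pose proof (PC_shift h1 hu) as hu'.
  pose proof (norm_PC_shift h1 hu) as hn.
  pose proof (norm_PC_nonneg hu') as hn0.
  destruct (hlim _ _ hu' hK) as (t & ht & hphi).
  exists (t + 1). split; [pose proof (Rmax_r 0 tau); lra|].
  rewrite phi_cocycle by (auto; lra).
  eapply Rle_trans; [exact hphi|]. eapply Rle_trans; [|exact ha].
  apply Rplus_le_compat_l. apply class_K_le; [exact hg|exact hn0|lra].
Qed.

Lemma ULIM_class_K : ULIM phi -> exists gamma, class_K gamma /\
  forall eps r, 0 < eps -> 0 < r -> exists tau, forall x u, PC u ->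
    norm x <= r -> exists t, 0 <= t <= tau /\
      norm (phi t x u) <= eps + gamma (norm_PC u).
Proof.
  intros (g & hg & h). destruct (class_K0_majorant hg) as (g' & hg' & hle).
  exists g'. split; [exact hg'|]. intros eps r he hr.
  destruct (h eps r he hr) as [tau ht]. exists tau. intros x u hu hx.
  destruct (ht x u hu hx) as (t & h1 & h2). exists t. split; [exact h1|].
  pose proof (hle _ (norm_PC_nonneg hu)). lra.
Qed.

(** The order of the choices matters: the radius a depends on eps through
    stability under the zero input alone, the horizon h on a and eps, and the
    input level b on all of them. *)
Lemma uniform_local_stability :
  ULIM phi -> zero_stable -> input_continuity_at_zero phi ->
  forall eps, 0 < eps -> exists delta, 0 < delta /\
    forall x u t, PC u -> norm x <= delta -> norm_PC u <= delta -> 0 <= t ->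
      norm (phi t x u) <= eps.
Proof.
  intros hL h0 (rho & hrho & hic) eps0 heps0.
  set (eps := Rmin eps0 rho).
  assert (heps : 0 < eps / 2).
  { assert (0 < eps) by (apply Rmin_pos; assumption). lra. }
  assert (hle : eps <= eps0) by apply Rmin_l.
  assert (hler : eps <= rho) by apply Rmin_r.
  destruct (ULIM_class_K hL) as (gamma & hg & hlim).
  destruct (h0 _ heps) as (d1 & hd1 & hz).
  set (a := Rmin 1 d1).
  assert (ha : 0 < a) by (apply Rmin_pos; lra).
  assert (ha1 : a <= 1) by apply Rmin_l.
  assert (had : a <= d1) by apply Rmin_r.
  assert (ha2 : 0 < a / 2) by lra. assert (he : 0 < eps) by lra.
  destruct (hlim _ _ ha2 he) as [tau htau].
  set (h := 1 + Rmax 0 tau).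
  assert (hh : 1 <= h) by (unfold h; pose proof (Rmax_l 0 tau); lra).
  assert (hh0 : 0 < h) by lra.
  destruct (hic _ _ heps hh0) as (d2 & hd2 & hnear).
  destruct (class_K_small hg ha2) as (d3 & hd3 & hgd3).
  set (b := Rmin d2 d3).
  assert (hb : 0 < b) by (apply Rmin_pos; assumption).
  assert (hbd2 : b <= d2) by apply Rmin_l.
  assert (hbd3 : b <= d3) by apply Rmin_r.
  assert (hgb : gamma b <= gamma d3) by (apply class_K_le; auto; lra).
  assert (hbound : forall x u t, PC u -> norm x <= a -> norm_PC u <= b ->
    0 <= t -> norm (phi t x u) <= eps).
  { apply bound_from_returns with h. intros x u hu hx hub.
    assert (hK : forall t, 0 <= t <= h -> norm (phi t x u) <= eps).
    { intros t ht.
      assert (hzx : forall t, 0 <= t -> norm (phi t x (fun _ => zero)) <= eps / 2)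
        by (intros s hs; apply hz; lra).
      pose proof (norm_le_ndist (phi t x u) (phi t x (fun _ => zero))) as htri.
      specialize (hzx t (proj1 ht)) as hzt.
      assert (hnt : ndist (phi t x u) (phi t x (fun _ => zero)) <= eps / 2).
      { apply hnear; auto; try lra. intros s hs. specialize (hzx s (proj1 hs)). lra. }
      lra. }
    split; [exact hK|].
    apply (ULIM_return_after_1 htau hg hu hub); [apply hK; lra|lra]. }
  exists (Rmin a b). split; [apply Rmin_pos; assumption|].
  intros x u t hu hx hub ht. apply Rle_trans with eps; [|exact hle].
  pose proof (Rmin_l a b). pose proof (Rmin_r a b).
  apply hbound; auto; lra.
Qed.

Lemma uniform_boundedness : ULIM phi -> BRS phi ->
  forall C, 0 < C -> exists K, forall x u t, PC u -> norm x <= C ->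
    norm_PC u <= C -> 0 <= t -> norm (phi t x u) <= K.
Proof.
  intros hL hB C hC. destruct (ULIM_class_K hL) as (gamma & hg & hlim).
  assert (hgC : 0 <= gamma C) by (apply class_K_nonneg; auto; lra).
  (* The ball must contain the initial states and the targets 1 + gamma C of ULIM. *)
  set (a := C + 1 + gamma C). assert (ha : 0 < a) by (unfold a; lra).
  destruct (hB a 1 ha Rlt_0_1) as [K1 hK1].
  assert (hR : 0 < Rmax 1 K1) by (pose proof (Rmax_l 1 K1); lra).
  destruct (hlim 1 _ Rlt_0_1 hR) as [tau htau].
  set (h := 1 + Rmax 0 tau).
  assert (hh : 1 <= h) by (unfold h; pose proof (Rmax_l 0 tau); lra).
  assert (hh0 : 0 < h) by lra.
  destruct (hB a h ha hh0) as [K hK].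
  exists K. intros x u t hu hx hub.
  assert (hxa : norm x <= a) by (unfold a; lra). clear hx.
  revert x u t hu hxa hub. apply bound_from_returns with h.
  intros x u hu hx hub. assert (huba : norm_PC u <= a) by (unfold a; lra).
  split; [intros t ht; apply hK; auto|].
  apply (ULIM_return_after_1 htau hg hu hub).
  - eapply Rle_trans; [|apply Rmax_r]. apply hK1; auto. lra.
  - unfold a. lra.
Qed.

(** State and input play the same part here: the size of a trajectory is the
    maximum of their norms. *)
Lemma uniform_gain : ULIM phi -> zero_stable ->
  input_continuity_at_zero phi -> BRS phi ->
  exists sigma, class_K sigma /\ forall x u t, PC u -> 0 <= t ->
    norm (phi t x u) <= sigma (norm x) + sigma (norm_PC u).
Proof.
  intros hL h0 hic hB.
  destruct (@class_K_envelope (fun a v => exists x u t, PC u /\ 0 <= t /\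
    a = Rmax (norm x) (norm_PC u) /\ v = norm (phi t x u)))
    as (sigma & hs & h).
  - intros a v (x & u & t & _ & _ & -> & _).
    eapply Rle_trans; [apply (norm_ge_0 x)|apply Rmax_l].
  - intros r. assert (hr : 0 < Rmax 1 r) by (pose proof (Rmax_l 1 r); lra).
    destruct (uniform_boundedness hL hB hr) as [K hK]. exists K.
    intros a v (x & u & t & hu & ht & -> & ->) ha.
    pose proof (Rmax_r 1 r). pose proof (Rmax_l (norm x) (norm_PC u)).
    pose proof (Rmax_r (norm x) (norm_PC u)). apply hK; auto; lra.
  - intros e he. destruct (uniform_local_stability hL h0 hic he) as (d & hd & hd').
    exists d. split; [exact hd|]. intros a v (x & u & t & hu & ht & -> & ->) ha.
    pose proof (Rmax_l (norm x) (norm_PC u)).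
    pose proof (Rmax_r (norm x) (norm_PC u)). apply hd'; auto; lra.
  - exists sigma. split; [exact hs|]. intros x u t hu ht.
    apply Rle_trans with (sigma (Rmax (norm x) (norm_PC u)));
      [apply h; exists x, u, t; auto|].
    pose proof (class_K_nonneg hs (norm_ge_0 x)).
    pose proof (class_K_nonneg hs (norm_PC_nonneg hu)).
    unfold Rmax. destruct (Rle_dec _ _); lra.
Qed.

(** From the time s at which ULIM brings the state to d/2 + g(w), the class K
    estimate restarts.  A number up to d/2 + g(w) is at most d or at most 2 g(w),
    so sigma of it is at most eps plus a function of w alone. *)
Lemma uniform_attraction (sigma : R -> R) : class_K sigma ->
  (forall x u t, PC u -> 0 <= t ->
    norm (phi t x u) <= sigma (norm x) + sigma (norm_PC u)) ->
  ULIM phi -> exists gamma, class_K gamma /\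
    forall eps r, 0 < eps -> 0 < r -> exists tau, forall x u t, PC u ->
      norm x <= r -> 0 <= t -> tau <= t ->
      norm (phi t x u) <= eps + gamma (norm_PC u).
Proof.
  intros hs hgs hL. destruct (ULIM_class_K hL) as (g & hg & hlim).
  exists (fun w => sigma (g w + g w) + sigma w). split.
  { apply class_K_plus; [|exact hs].
    apply (class_K_comp hs (class_K_plus hg hg)). }
  intros eps r he hr. destruct (class_K_small hs he) as (d & hd & hsd).
  assert (hd2 : 0 < d / 2) by lra.
  destruct (hlim _ _ hd2 hr) as [tau htau]. exists tau.
  intros x u t hu hx ht0 ht. destruct (htau x u hu hx) as (s & hst & hphi).
  set (w := norm_PC u) in *.
  assert (hw : 0 <= w) by apply norm_PC_nonneg, hu.
  pose proof (class_K_nonneg hg hw) as hgw.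
  replace t with (t - s + s) by ring. rewrite phi_cocycle by (auto; lra).
  assert (hs0 : 0 <= s) by lra. pose proof (PC_shift hs0 hu) as hu'.
  eapply Rle_trans; [apply hgs; [exact hu'|lra]|].
  assert (h1 : sigma (norm_PC (fun r => u (r + s))) <= sigma w).
  { apply class_K_le; [exact hs|apply norm_PC_nonneg, hu'|].
    apply norm_PC_shift; assumption. }
  assert (hgg : 0 <= g w + g w) by lra.
  pose proof (class_K_nonneg hs hgg) as hsg.
  assert (hd0 : 0 <= d) by lra.
  pose proof (class_K_nonneg hs hd0) as hsd0.
  assert (h2 : sigma (norm (phi s x u)) <= sigma d + sigma (g w + g w)).
  { pose proof (norm_ge_0 (phi s x u)).
    destruct (Rle_dec (norm (phi s x u)) d) as [hc|hc].
    - assert (sigma (norm (phi s x u)) <= sigma d)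
        by (apply class_K_le; auto). lra.
    - assert (sigma (norm (phi s x u)) <= sigma (g w + g w))
        by (apply class_K_le; auto; lra). lra. }
  lra.
Qed.

(** The excess of a trajectory over the gain g has the three properties asked by
    [KL_envelope]: subtracting sigma of the input leaves at most sigma of the
    initial norm, and subtracting gamma leaves decay uniform on balls. *)
Lemma ISS_of_ULIM : ULIM phi -> zero_stable ->
  input_continuity_at_zero phi -> BRS phi -> ISS phi.
Proof.
  intros hL h0 hic hB.
  destruct (uniform_gain hL h0 hic hB) as (sigma & hs & hgs).
  destruct (uniform_attraction hs hgs hL) as (gamma & hg & hatt).
  set (g := fun w => sigma w + gamma w).
  assert (hgK : class_K g) by (apply class_K_plus; assumption).
  assert (hpos : forall u : R -> U, PC u ->
    0 <= sigma (norm_PC u) /\ 0 <= gamma (norm_PC u)).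
  { intros u hu. pose proof (norm_PC_nonneg hu).
    split; apply class_K_nonneg; assumption. }
  destruct (@KL_envelope (fun a t v => exists x u, PC u /\ 0 <= t /\
    a = norm x /\ v = norm (phi t x u) - g (norm_PC u)))
    as (beta & hbeta & h).
  - intros a t v (x & u & _ & ht & -> & _). split; [apply norm_ge_0|exact ht].
  - intros r. exists (sigma (Rmax 0 r)).
    intros a t v (x & u & hu & ht & -> & ->) ha.
    pose proof (hgs x u t hu ht). pose proof (hpos u hu).
    assert (sigma (norm x) <= sigma (Rmax 0 r)).
    { apply class_K_le; [exact hs|apply norm_ge_0|].
      eapply Rle_trans; [exact ha|apply Rmax_r]. }
    unfold g. lra.
  - intros e he. destruct (class_K_small hs he) as (d & hd & hsd).
    exists d. split; [exact hd|].
    intros a t v (x & u & hu & ht & -> & ->) ha.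
    pose proof (hgs x u t hu ht). pose proof (hpos u hu).
    assert (sigma (norm x) <= sigma d)
      by (apply class_K_le; [exact hs|apply norm_ge_0|exact ha]).
    unfold g. lra.
  - intros e r he hr. destruct (hatt e r he hr) as [tau htau]. exists tau.
    intros a t v (x & u & hu & ht & -> & ->) ha htt.
    pose proof (htau x u t hu ha ht htt). pose proof (hpos u hu).
    unfold g. lra.
  - exists beta, g. split; [exact hbeta|split; [exact hgK|]].
    intros x u t hu ht.
    assert (norm (phi t x u) - g (norm_PC u) <= beta (norm x) t); [|lra].
    apply h. exists x, u. auto.
Qed.

End Stability.

(** * Implications between the stability notions *)

Section Implications.

Variable X : CompleteNormedModule R_AbsRing.
Variable U : NormedModule R_AbsRing.
Variable phi : R -> X -> (R -> U) -> X.

Lemma class_KL_le (beta : R -> R -> R) (r s t t' : R) : class_KL beta ->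
  0 <= r -> r <= s -> 0 <= t -> t <= t' -> beta r t' <= beta s t.
Proof.
  intros (_ & hK & hLL) hr hs ht ht'. apply Rle_trans with (beta r t).
  - destruct (Rle_lt_or_eq_dec _ _ ht') as [h|<-]; [|lra].
    destruct (Rle_lt_or_eq_dec _ _ hr) as [hr'|<-].
    + left. apply (hLL r hr'); assumption.
    + assert (h0 : forall q, 0 <= q -> beta 0 q = 0) by (intros q hq; apply hK, hq).
      rewrite !h0; lra.
  - apply (@class_K_le (fun r => beta r t)); [apply hK, ht|exact hr|exact hs].
Qed.

(** Adding the identity to gamma makes it unbounded. *)
Lemma ISS_UAG : ISS phi -> UAG phi.
Proof.
  intros (beta & gamma & hb & hg & h).
  exists (fun w => gamma w + w). split; [left; apply class_K_add_id, hg|].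
  intros eps r he hr.
  destruct (proj2 (proj2 hb) r hr) as (_ & _ & hlim).
  apply is_lim_spec in hlim. destruct (hlim (mkposreal eps he)) as [M hM].
  simpl in hM. set (tau := Rmax 0 (M + 1)).
  assert (htau : 0 <= tau) by apply Rmax_l.
  exists tau. split; [exact htau|].
  intros u x t hu hx ht.
  assert (ht0 : 0 <= t) by lra.
  pose proof (h x u t hu ht0). pose proof (norm_PC_nonneg hu).
  assert (beta (norm x) t <= beta r tau)
    by (apply class_KL_le; auto; [apply norm_ge_0|lra]).
  assert (hMt : M < tau) by (pose proof (Rmax_r 0 (M + 1)); unfold tau; lra).
  specialize (hM tau hMt). apply Rabs_def2 in hM. lra.
Qed.

Lemma ISS_UGS : ISS phi -> UGS phi.
Proof.
  intros (beta & gamma & hb & hg & h).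
  exists (fun r => beta r 0 + r), (fun w => gamma w + w).
  split; [apply (@class_K_add_id (fun r => beta r 0)), hb; lra|].
  split; [left; apply class_K_add_id, hg|].
  intros x u t hu ht. pose proof (h x u t hu ht).
  pose proof (norm_PC_nonneg hu). pose proof (norm_ge_0 x).
  assert (beta (norm x) t <= beta (norm x) 0)
    by (apply class_KL_le; auto; lra).
  lra.
Qed.

Lemma UGS_BRS : UGS phi -> BRS phi.
Proof.
  intros (sigma & gamma & hs & hg & h) C tau hC htau.
  destruct (class_K0_majorant (class_Kinf0_K0 hg)) as (g & hgK & hle).
  exists (sigma C + g C). intros x u t hu hx hub ht.
  pose proof (norm_PC_nonneg hu) as hn.
  eapply Rle_trans; [apply h; auto; lra|].
  apply Rplus_le_compat.
  - apply class_K_le; [apply hs|apply norm_ge_0|exact hx].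
  - eapply Rle_trans; [apply hle, hn|]. apply class_K_le; assumption.
Qed.

Lemma UGS_ULS : UGS phi -> ULS phi.
Proof.
  intros (sigma & gamma & hs & hg & h). exists sigma, gamma, 1.
  repeat split; try apply hs; auto; lra.
Qed.

Lemma ULS_zero_ULS : ULS phi -> zero_ULS phi.
Proof.
  intros (sigma & gamma & r & hs & hg & hr & h). exists sigma, r.
  split; [exact hs|split; [exact hr|]]. intros x t hx ht.
  assert (hn : norm_PC (fun _ : R => zero : U) <= r)
    by (rewrite norm_PC_zero; lra).
  pose proof (h x _ t (PC_zero U) hx hn ht) as hb.
  rewrite norm_PC_zero, (class_K0_at_0 (class_Kinf0_K0 hg)) in hb. lra.
Qed.

Lemma zero_ULS_zero_stable : zero_ULS phi -> zero_stable phi.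
Proof.
  intros (sigma & r & [hs _] & hr & h) eps he.
  destruct (class_K_small hs he) as (d & hd & hsd).
  exists (Rmin d r). split; [apply Rmin_pos; assumption|].
  intros x t hx ht. pose proof (Rmin_l d r). pose proof (Rmin_r d r).
  eapply Rle_trans; [apply h; lra|]. eapply Rle_trans; [|exact hsd].
  apply class_K_le; [exact hs|apply norm_ge_0|lra].
Qed.

Lemma UAG_ULIM : UAG phi -> ULIM phi.
Proof.
  intros (gamma & hg & h). exists gamma. split; [apply class_Kinf0_K0, hg|].
  intros eps r he hr. assert (hr1 : 0 < r + 1) by lra.
  destruct (h eps _ he hr1) as (tau & htau & hb). exists tau.
  intros x u hu hx. exists tau. split; [lra|]. apply hb; [exact hu|lra|lra].
Qed.

(** UAG bounds the trajectories of the unit ball by eps from time tau on, and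
    continuity at the equilibrium covers the times before. *)
Lemma UAG_zero_stable : UAG phi ->
  (forall eps h, 0 < eps -> 0 < h -> exists delta, 0 < delta /\
    forall x t, norm x <= delta -> 0 <= t <= h ->
      norm (phi t x (fun _ => zero)) <= eps) ->
  zero_stable phi.
Proof.
  intros (gamma & hg & h) hsmall eps he.
  destruct (h eps 1 he Rlt_0_1) as (tau & htau & hb).
  assert (hh : 0 < tau + 1) by lra.
  destruct (hsmall eps _ he hh) as (d & hd & hd').
  exists (Rmin (1 / 2) d). split; [apply Rmin_pos; lra|].
  intros x t hx ht. pose proof (Rmin_l (1 / 2) d). pose proof (Rmin_r (1 / 2) d).
  destruct (Rle_dec t (tau + 1)) as [htt|htt].
  - apply hd'; lra.
  - assert (hx1 : norm x < 1) by lra. assert (htau' : tau <= t) by lra.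
    pose proof (hb _ x t (PC_zero U) hx1 htau') as hbt.
    rewrite norm_PC_zero, (class_K0_at_0 (class_Kinf0_K0 hg)) in hbt. lra.
Qed.

End Implications.

Theorem theorem6
  (X : CompleteNormedModule R_AbsRing) (U : NormedModule R_AbsRing)
  (T : R -> X -> X) (D : X -> Prop) (A : X -> X) (f : X -> U -> X)
  (hT : C0_semigroup T)
  (hA : is_generator T D A)
  (hf1 : lipschitz_on_balls f)
  (hf2 : continuous_in_input f)
  (hf2' : f zero zero = zero)
  (hf3 : input_K_bound f)
  (hfc : forward_complete T f) :
  (ISS (flow T f) <-> UAG (flow T f) /\ BRS (flow T f)) /\
  (ISS (flow T f) <-> ULIM (flow T f) /\ ULS (flow T f) /\ BRS (flow T f)) /\
  (ISS (flow T f) <-> ULIM (flow T f) /\ UGS (flow T f)) /\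
  (ISS (flow T f) <-> ULIM (flow T f) /\ zero_ULS (flow T f) /\ BRS (flow T f)).
Proof.
  assert (core : ULIM (flow T f) -> zero_stable (flow T f) -> BRS (flow T f) ->
    ISS (flow T f)).
  { intros hL h0 hB. apply ISS_of_ULIM; auto.
    - intros x u s t. apply flow_cocycle; assumption.
    - apply flow_input_continuity; assumption. }
  assert (hBRS : ISS (flow T f) -> BRS (flow T f))
    by (intros h; apply UGS_BRS, ISS_UGS, h).
  assert (hULIM : ISS (flow T f) -> ULIM (flow T f))
    by (intros h; apply UAG_ULIM, ISS_UAG, h).
  assert (hULS : ISS (flow T f) -> ULS (flow T f))
    by (intros h; apply UGS_ULS, ISS_UGS, h).
  split; [|split; [|split]]; split.
  - intros h. split; [apply ISS_UAG, h|auto].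
  - intros [h hB]. apply core; [apply UAG_ULIM, h| |exact hB].
    apply UAG_zero_stable; [exact h|]. intros eps r he hr.
    apply flow_small_data; assumption.
  - auto.
  - intros (hL & hS & hB). apply core; auto.
    apply zero_ULS_zero_stable, ULS_zero_ULS, hS.
  - intros h. split; [auto|apply ISS_UGS, h].
  - intros (hL & hG). apply core; auto; [|apply UGS_BRS, hG].
    apply zero_ULS_zero_stable, ULS_zero_ULS, UGS_ULS, hG.
  - intros h. split; [auto|split; [apply ULS_zero_ULS; auto|auto]].
  - intros (hL & hS & hB). apply core; auto. apply zero_ULS_zero_stable, hS.
Qed.
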